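(* (1) There exist constants $\alpha_0,\alpha_1,\alpha_2>0$ such that for all $\varphi\in\mathbb{B}$ and all $z\in\mathbb{C}$: (i) $|\varphi(z)|\le e^{\frac{|z|^2}{2}}\|\varphi\|_{\mathbb{B}}$; (ii) $|\varphi'(z)|\le(1+|z|^2)^{\frac12}e^{\frac{|z|^2}{2}}\|\varphi\|_{\mathbb{B}}$; (iii) $|\varphi''(z)|\le(\alpha_0+\alpha_1|z|^2+\alpha_2|z|^4)^{\frac12}e^{\frac{|z|^2}{2}}\|\varphi\|_{\mathbb{B}}$. (2) $\mathbb{B}$ is a closed subspace of $L_2(\mathbb{C},d\mu(z))$.
   Context: $L_2(\mathbb{C},d\mu(z))$ is the Hilbert space of (classes of) measurable functions $\varphi:\mathbb{C}\to\mathbb{C}$ with norm $\|\varphi\|=\left(\frac1\pi\int_{\mathbb{C}}|\varphi(z)|^2e^{-|z|^2}dx\,dy\right)^{1/2}<\infty$. The Bargmann space $\mathbb{B}$ is the subspace of entire functions in it, with the same norm $\|\cdot\|_{\mathbb{B}}$. *)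

(* Defs.v *)
From HB Require Import structures.
From mathcomp Require Import all_boot all_order all_algebra.
From mathcomp Require Import all_classical all_reals all_analysis.
From mathcomp Require Import measurable_realfun ring_quotient.
From mathcomp.real_closed Require Import complex.
Set Implicit Arguments.
Unset Strict Implicit.
Unset Printing Implicit Defensive.
Import Order.TTheory GRing.Theory Num.Theory.
Import numFieldNormedType.Exports.
Import Normc.

Local Open Scope ring_scope.
Local Open Scope complex_scope.
Local Open Scope classical_set_scope.

(* The complex field as a one-dimensional normed space over itself, so that
   [derivable f z 1] and [f^`()] refer to complex differentiation. *)
HB.instance Definition _ (R : realType) := NormedModule.copy R[i] R[i]^o.

Section L2.
Context {R : realType}.

(* Integrals over the complex plane are taken over R * R with the product
   Lebesgue measure, through (x, y) |-> x + iy; measurability is Borel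
   measurability, which yields the same classes modulo null sets as Lebesgue
   measurability. *)
Local Notation plane := (measurableTypeR R * measurableTypeR R)%type.

Definition cplx (p : plane) : R[i] := p.1 +i* p.2.

Definition leb2 : {measure set plane -> \bar R} :=
  (@lebesgue_measure R \x @lebesgue_measure R)%E.

Definition cmeasurable (f : R[i] -> R[i]) : Prop :=
  measurable_fun [set: plane] (fun p => complex.Re (f (cplx p))) /\
  measurable_fun [set: plane] (fun p => complex.Im (f (cplx p))).

Definition enorm (f : R[i] -> R[i]) : \bar R :=
  (((pi^-1)%:E * \int[leb2]_p
     (normc (f (cplx p)) ^+ 2 * expR (- normc (cplx p) ^+ 2))%:E) `^ 2^-1)%E.

Definition l2pred : {pred R[i] -> R[i]} :=
  mem [set f | cmeasurable f /\ (enorm f < +oo)%E].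

Let wfun (f : R[i] -> R[i]) (p : plane) : R :=
  normc (f (cplx p)) * expR (- normc (cplx p) ^+ 2 / 2).

Let normc_ge0 (z : R[i]) : 0 <= normc z.
Proof. by case: z => a b; exact: sqrtr_ge0. Qed.

Let enormE f :
  enorm f = ((Num.sqrt pi^-1)%:E * 'N[leb2]_2%:E[EFin \o wfun f])%E.
Proof.
have ipi : 0 <= (pi : R)^-1 by rewrite invr_ge0 pi_ge0.
have I0 : (0 <= \int[leb2]_p
    (normc (f (cplx p)) ^+ 2 * expR (- normc (cplx p) ^+ 2))%:E)%E.
  by apply: integral_ge0 => p _; rewrite lee_fin mulr_ge0// ?expR_ge0// sqr_ge0.
rewrite /enorm poweRM ?lee_fin//; congr (_ * _)%E.
  by rewrite poweR_EFin powR12_sqrt.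
rewrite unlock; congr (_ `^ _)%E; apply: eq_integral => p _ /=.
rewrite ger0_norm ?mulr_ge0// ?expR_ge0// powR_mulrn; last first.
  by rewrite mulr_ge0// expR_ge0.
by rewrite exprMn -expRM_natl mulrCA divff// mulr1.
Qed.

Let measurable_normcf f : cmeasurable f ->
  measurable_fun [set: plane] (fun p => normc (f (cplx p))).
Proof.
move=> [mr mi].
rewrite (_ : (fun p => _) =
   Num.sqrt \o (fun p => complex.Re (f (cplx p)) ^+ 2 + complex.Im (f (cplx p)) ^+ 2)).
  apply: measurableT_comp.
    exact: continuous_measurable_fun (@sqrt_continuous R).
  by apply: measurable_funD; apply: measurable_funX.
by apply/funext => p /=; case: (f _).
Qed.

Let cmeasurable_id : cmeasurable id.
Proof. by split; [exact: measurable_fst|exact: measurable_snd]. Qed.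

Let measurable_wfun f : cmeasurable f -> measurable_fun [set: plane] (wfun f).
Proof.
move=> mf; apply: measurable_funM; first exact: measurable_normcf.
apply: measurableT_comp => //; apply: measurable_funM => //.
apply: measurableT_comp => //; apply: measurable_funX.
exact: measurable_normcf cmeasurable_id.
Qed.

Let measurable_pow2 (h : plane -> R) : measurable_fun [set: plane] h ->
  measurable_fun [set: plane] (fun p => `|(EFin \o h) p| `^ 2)%E.
Proof.
move=> mh; apply: (measurableT_comp (measurable_poweR _)).
by apply: measurableT_comp => //; exact/measurable_EFinP.
Qed.

Lemma cmeasurable_lin (a : R[i]) f g : cmeasurable f -> cmeasurable g ->
  cmeasurable (a *: f + g).
Proof.
move=> [rf jf] [rg jg]; case: a => a b; split.
  rewrite (_ : (fun p => _) = (fun p =>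
    (a * complex.Re (f (cplx p)) - b * complex.Im (f (cplx p))) + complex.Re (g (cplx p)))).
    apply: measurable_funD => //; apply: measurable_funB;
    by apply: measurable_funM.
  apply/funext => p; rewrite [X in complex.Re X]/(_ * f (cplx p) + g (cplx p)).
  by case: (f _) (g _) => c d [].
rewrite (_ : (fun p => _) = (fun p =>
    (a * complex.Im (f (cplx p)) + b * complex.Re (f (cplx p))) + complex.Im (g (cplx p)))).
  apply: measurable_funD => //; apply: measurable_funD;
  by apply: measurable_funM.
apply/funext => p; rewrite [X in complex.Im X]/(_ * f (cplx p) + g (cplx p)).
by case: (f _) (g _) => c d [].
Qed.

Lemma enormZ a f : cmeasurable f ->
  enorm (a *: f) = ((normc a)%:E * enorm f)%E.
Proof.
move=> mf; rewrite /enorm.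
under eq_integral => p _ do rewrite [X in normc X]/(a * f (cplx p)) normcM
  exprMn -mulrA EFinM.
have m : measurable_fun [set: plane] (fun p : plane =>
    (normc (f (cplx p)) ^+ 2 * expR (- normc (cplx p) ^+ 2))%:E).
  apply/measurable_EFinP; apply: measurable_funM.
    by apply: measurable_funX; exact: measurable_normcf.
  apply: measurableT_comp => //; apply: measurableT_comp => //.
  by apply: measurable_funX; exact: measurable_normcf cmeasurable_id.
have ge0 p : (0 <= (normc (f (cplx p)) ^+ 2 * expR (- normc (cplx p) ^+ 2))%:E)%E.
  by rewrite lee_fin mulr_ge0// ?expR_ge0// sqr_ge0.
rewrite ge0_integralZl ?lee_fin ?sqr_ge0//.
set I := integral _ _ _.
rewrite muleCA (@poweRM _ (normc a ^+ 2)%:E) ?lee_fin ?sqr_ge0//; last first.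
  by apply: mule_ge0; [rewrite lee_fin invr_ge0 pi_ge0|exact: integral_ge0].
congr (_ * _)%E.
by rewrite poweR_EFin powR12_sqrt ?sqr_ge0// sqrtr_sqr ger0_norm.
Qed.

Lemma enormD f g : cmeasurable f -> cmeasurable g ->
  (enorm (f + g)%R <= enorm f + enorm g)%E.
Proof.
move=> mf mg; rewrite !enormE -ge0_muleDr ?Lnorm_ge0//.
apply: lee_wpmul2l; first by rewrite lee_fin sqrtr_ge0.
have mk := @minkowski_EFin _ _ _ leb2 (wfun f) (wfun g) 2.
have {mk} := mk (measurable_wfun mf) (measurable_wfun mg) (ler1n _ _).
apply: le_trans.
have mfg : cmeasurable (f + g) by rewrite -[f]scale1r; exact: cmeasurable_lin.
rewrite unlock; apply: gt0_ler_poweR => //.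
- by rewrite in_itv/= leey integral_ge0// => p _; rewrite poweR_ge0.
- by rewrite in_itv/= leey integral_ge0// => p _; rewrite poweR_ge0.
apply: ge0_le_integral => //.
- by move=> p _ /=; rewrite lee_fin powR_ge0.
- by apply: measurable_pow2; exact: measurable_wfun.
- by apply: measurable_pow2; apply: measurable_funD; exact: measurable_wfun.
move=> p _ /=; rewrite lee_fin ge0_ler_powR ?nnegrE//.
have w0 h : 0 <= wfun h p by rewrite mulr_ge0// expR_ge0.
rewrite !ger0_norm ?addr_ge0// /wfun -mulrDl ler_wpM2r ?expR_ge0//.
exact: le_normcD.
Qed.

Lemma enorm_eq0 f : cmeasurable f -> enorm f = 0%E ->
  {ae leb2, forall p, f (cplx p) = 0}.
Proof.
move=> mf; rewrite enormE => /eqP; rewrite mule_eq0 => /orP[|].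
  by rewrite eqe sqrtr_eq0 leNgt invr_gt0 pi_gt0.
move=> /eqP /Lnorm_eq0_eq0 /= h.
have : ae_eq leb2 setT (EFin \o wfun f) \0%E.
  by apply: h; [apply/measurable_EFinP; exact: measurable_wfun|rewrite lte_fin].
apply: filterS => p /(_ I) [] /eqP; rewrite mulf_eq0 (gt_eqF (expR_gt0 _)) orbF.
by move=> /eqP /eq0_normc.
Qed.

Lemma ae_eq_enorm f g : cmeasurable f -> cmeasurable g ->
  {ae leb2, forall p, f (cplx p) = g (cplx p)} -> enorm f = enorm g.
Proof.
move=> mf mg fg; rewrite !enormE; congr (_ * _)%E.
rewrite unlock; congr (_ `^ _)%E.
apply: ge0_ae_eq_integral => //.
- by apply: measurable_pow2; exact: measurable_wfun.
- by apply: measurable_pow2; exact: measurable_wfun.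
- by move=> p _; exact: poweR_ge0.
- by move=> p _; exact: poweR_ge0.
by apply: filterS fg => p + _; rewrite /= /wfun => ->.
Qed.

Lemma l2pred_submod : submod_closed l2pred.
Proof.
split.
  rewrite inE /=; have m0 : cmeasurable 0 by split; exact: measurable_cst.
  split=> //; rewrite -[0](scale0r (0 : R[i] -> R[i])) enormZ// normc0 mul0e.
  exact: ltry.
move=> a f g; rewrite !inE /= => -[mf lf] [mg lg].
split; first exact: cmeasurable_lin.
have maf : cmeasurable (a *: f).
  by rewrite -[_ *: _]addr0; apply: cmeasurable_lin => //; split; exact: measurable_cst.
apply: le_lt_trans (enormD maf mg) _; rewrite enormZ// lte_add_pinfty//.
by rewrite lte_mul_pinfty// lee_fin.
Qed.

HB.instance Definition _ :=
  GRing.isSubmodClosed.Build R[i] (R[i] -> R[i]) l2pred l2pred_submod.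

End L2.
Arguments l2pred R : clear implicits.

Record L2fun (R : realType) := MkL2fun {
  L2val :> R[i] -> R[i];
  _ : L2val \in l2pred R }.

Section L2space.
Context {R : realType}.

HB.instance Definition _ := [isSub for @L2val R].
HB.instance Definition _ := [Choice of L2fun R by <:].
HB.instance Definition _ := [SubChoice_isSubLmodule of L2fun R by <:].

Lemma L2fun_measurable (f : L2fun R) : cmeasurable f.
Proof. by have := valP f; rewrite inE => -[]. Qed.

Lemma L2fun_fin (f : L2fun R) : enorm f \is a fin_num.
Proof.
have := valP f; rewrite inE => -[_ /= fo].
by rewrite ge0_fin_numE// poweR_ge0.
Qed.

Definition l2norm (f : L2fun R) : R := fine (enorm f).

(* The Gaussian measure has a positive density, so it has the same null sets as
   [leb2]. *)
Definition ae0 : {pred L2fun R} :=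
  mem [set f : L2fun R | {ae @leb2 R, forall p, f (cplx p) = 0}].

Lemma ae0_submod : submod_closed ae0.
Proof.
split; first by rewrite inE /=; apply: aeW => p.
move=> a f g; rewrite !inE /=; apply: filterS2 => p.
by rewrite /= => fp gp; rewrite -[LHS]/(a * f (cplx p) + g (cplx p)) fp gp mulr0 addr0.
Qed.

HB.instance Definition _ :=
  GRing.isSubmodClosed.Build R[i] (L2fun R) ae0 ae0_submod.

End L2space.

Definition L2 (R : realType) := {ideal_quot @ae0 R}.

Section L2quotient.
Context {R : realType}.
Local Open Scope quotient_scope.

HB.instance Definition _ := GRing.Zmodule.on (L2 R).
HB.instance Definition _ := EqQuotient.on (L2 R).

Definition toL2 (f : L2fun R) : L2 R := \pi_(L2 R) f.

Lemma toL2K u : toL2 (repr u) = u.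
Proof. exact: reprK. Qed.

Lemma toL2B f g : toL2 (f - g) = toL2 f - toL2 g.
Proof. exact: raddfB. Qed.

Lemma toL2D f g : toL2 (f + g) = toL2 f + toL2 g.
Proof. exact: raddfD. Qed.

Lemma toL2_eq (f g : L2fun R) :
  toL2 f = toL2 g <-> {ae @leb2 R, forall p, f (cplx p) = g (cplx p)}.
Proof.
have <- : (f - g \in @ae0 R) <-> {ae @leb2 R, forall p, f (cplx p) = g (cplx p)}.
  rewrite inE /=; split; apply: filterS => p.
    by rewrite -[X in X = 0]/(f (cplx p) - g (cplx p)) => /eqP; rewrite subr_eq0 => /eqP.
  by rewrite -[X in _ -> X = 0]/(f (cplx p) - g (cplx p)) => ->; rewrite subrr.
rewrite Quotient.idealrBE; exact: rwP eqP.
Qed.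

Definition L2scale (a : R[i]) (u : L2 R) : L2 R := toL2 (a *: repr u).

Lemma toL2Z a f : toL2 (a *: f) = L2scale a (toL2 f).
Proof.
have /toL2_eq rE := toL2K (toL2 f).
apply/toL2_eq; move: rE.
apply: filterS => p fE.
by rewrite -[LHS]/(a * f (cplx p)) -[RHS]/(a * repr (toL2 f) (cplx p)) fE.
Qed.

Let L2scaleA a b u : L2scale a (L2scale b u) = L2scale (a * b) u.
Proof. by rewrite -[u]toL2K -!toL2Z scalerA. Qed.

Let L2scale1 : left_id 1 L2scale.
Proof. by move=> u; rewrite -[u]toL2K -toL2Z scale1r. Qed.

Let L2scaleDr : right_distributive L2scale +%R.
Proof.
move=> a u v; rewrite -[u]toL2K -[v]toL2K -!toL2Z -[X in L2scale _ X]toL2D.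
by rewrite -toL2Z scalerDr toL2D.
Qed.

Let L2scaleDl u a b : L2scale (a + b) u = L2scale a u + L2scale b u.
Proof. by rewrite -[u]toL2K -!toL2Z scalerDl toL2D. Qed.

HB.instance Definition _ := GRing.Zmodule_isLmodule.Build R[i] (L2 R)
  L2scaleA L2scale1 L2scaleDr L2scaleDl.

(* Norms of normed spaces over [R[i]] take values in [R[i]]. *)
Definition L2norm (u : L2 R) : R[i] := (l2norm (repr u))%:C.

Lemma L2norm_toL2 f : L2norm (toL2 f) = (l2norm f)%:C.
Proof.
congr (fine _)%:C; apply: ae_eq_enorm; [exact: L2fun_measurable..|].
by apply/toL2_eq; exact: toL2K.
Qed.

Let L2normD u v : L2norm (u + v) <= L2norm u + L2norm v.
Proof.
rewrite -[u]toL2K -[v]toL2K -[X in L2norm X]toL2D !L2norm_toL2 -rmorphD lecR.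
rewrite -lee_fin EFinD /l2norm !fineK ?L2fun_fin//.
by apply: enormD; exact: L2fun_measurable.
Qed.

Let L2normZ (a : R[i]) u : L2norm (a *: u) = `|a| * L2norm u.
Proof.
rewrite -[u]toL2K -[X in L2norm X]toL2Z !L2norm_toL2.
rewrite -[`|a|]/((normc a)%:C) -rmorphM; congr _%:C.
rewrite /l2norm (@enormZ R a (repr u)); last exact: L2fun_measurable.
by rewrite fineM// L2fun_fin.
Qed.

Let L2norm0_eq0 u : L2norm u = 0 -> u = 0.
Proof.
rewrite -[u]toL2K L2norm_toL2 => -[] f0.
rewrite -(raddf0 (\pi_(L2 R))); apply/toL2_eq.
apply: enorm_eq0; first exact: L2fun_measurable.
by rewrite -[LHS]fineK ?L2fun_fin// -/(l2norm _) f0.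
Qed.

HB.instance Definition _ := Lmodule_isNormed.Build R[i] (L2 R)
  L2normD L2normZ L2norm0_eq0.

Lemma L2normE (f : L2fun R) : `|toL2 f| = (l2norm f)%:C.
Proof. exact: L2norm_toL2. Qed.

End L2quotient.

Definition entire (R : realType) (f : R[i] -> R[i]) : Prop :=
  forall z, derivable f z 1.

Definition bargmann (R : realType) : set (L2fun R) := [set f | entire f].
Arguments bargmann R : clear implicits.

(* The classes having an entire representative. *)
Definition bargmannL2 (R : realType) : set (L2 R) := toL2 @` bargmann R.
Arguments bargmannL2 R : clear implicits.

(* Main.v *)
Require Import Defs.
From HB Require Import structures.
From mathcomp Require Import all_boot all_order all_algebra.
From mathcomp Require Import all_classical all_reals all_analysis.
From mathcomp.real_closed Require Import complex.
From mathcomp Require Import measurable_realfun ring lra.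
Import Order.TTheory GRing.Theory Num.Theory.
Import numFieldNormedType.Exports.
Import Normc.
Local Open Scope ring_scope.
Local Open Scope complex_scope.
Local Open Scope classical_set_scope.

(* Goursat's lemma on squares, in the logarithmic coordinate, shows that the mean
   of an entire function over a circle centered at 0 is its value at 0. Lebesgue
   measure on the plane is invariant under rotations, so the same holds for the
   Gaussian mean. Applied to u |-> phi(a + u) exp(- conj(a) u) and combined with
   translation invariance, this is the reproducing formula
     phi(a) = 1/pi * int phi(w) exp(a conj(w)) exp(-|w|^2) dw.
   The right-hand side is defined, and complex differentiable in a under the
   integral sign, for every phi in L2. Cauchy-Schwarz bounds the m-th derivative
   of phi by the norm of the kernel w^m exp(conj(a) w), and the square of that norm
   is the m-th derivative of this entire function at a, by the reproducing formula
   again. Closedness: if entire phi_n tend to f in L2, they tend pointwise to the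
   projection of f, which is entire and equals f almost everywhere by Fatou. *)

(** * Invariance of the plane Lebesgue measure *)

Section plane_measure.
Context {R : realType}.
Local Notation plane := (measurableTypeR R * measurableTypeR R)%type.
Local Notation mu := (@lebesgue_measure R).
Local Notation leb2 := (@leb2 R).

(** In the coordinate z with w exp(2 pi z), turning once around the circle is z -> z + i, so the
    integrand is periodic and the two horizontal sides of a unit square cancel. Goursat's lemma then
    says that the mean over a vertical unit segment does not change when the segment moves left by
    1. Moving left shrinks the circle towards 0, where continuity of the function is enough. Unit
    squares are thus the only contours, and continuity of the derivative is never assumed.
    Derivatives are bounded through the kernel rather than by Cauchy estimates on discs because the
    norm of the first kernel derivative is exactly the required factor (1 + |z|^2)^(1/2)
    exp(|z|^2/2). In the same way the second derivative of w^2 exp(conj(a) w) at w = a is (2 + 4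
    |a|^2 + |a|^4) exp(|a|^2), which is where the constants 2, 4, 1 come from. *)

Lemma lebesgue_measure_shift (c : R) (A : set R) : measurable A ->
  mu ((fun x => x + c) @^-1` A) = mu A.
Proof.
move=> mA; apply/esym.
have mT : measurable_fun [set: measurableTypeR R] (fun x : R => x + c : measurableTypeR R).
  by apply: measurable_funD.
apply: (@lebesgue_measure_unique _ (pushforward mu (fun x : R => x + c : measurableTypeR R))) => //.
move=> X [[a b]] /= _ <-; rewrite /pushforward.
have -> : (fun x : R => x + c) @^-1` `]a, b]%classic = `]a - c, b - c]%classic.
  by apply/seteqP; split => x /=; rewrite !in_itv/= ltrBlDr lerBrDr.
by rewrite !lebesgue_measure_itv/= !lte_fin ltrD2r -!EFinB opprB addrA subrK.
Qed.

Definition leb2_preserving (T : plane -> plane) : Prop :=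
  measurable_fun setT T /\
  forall A, measurable A -> leb2 (T @^-1` A) = leb2 A.

Lemma leb2_preserving_comp S T :
  leb2_preserving S -> leb2_preserving T -> leb2_preserving (S \o T).
Proof.
move=> [mS pS] [mT pT]; split; first exact: measurableT_comp.
move=> A mA; rewrite comp_preimage pT ?pS//.
by rewrite -[X in measurable X]setTI; exact: mS.
Qed.

(** A shear translates each vertical section, and the measure of a plane set is the integral of the
    measures of its sections. *)
Lemma leb2_preserving_shear (h : R -> R) : measurable_fun setT h ->
  leb2_preserving (fun p => (p.1, p.2 + h p.1)).
Proof.
move=> mh.
have mT : measurable_fun setT (fun p : plane => (p.1, p.2 + h p.1) : plane).
  apply/measurable_fun_pairP; split => /=; first exact: measurable_fst.
  apply: measurable_funD; first exact: measurable_snd.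
  exact: measurableT_comp mh measurable_fst.
split=> // A mA; rewrite /leb2 /product_measure1; apply: eq_integral => x _ /=.
rewrite -[RHS](lebesgue_measure_shift (h x)); last exact: measurable_xsection.
by rewrite /xsection.
Qed.

(** The pushforward agrees with the product measure on rectangles, and this determines it. *)
Lemma leb2_preserving_swap : leb2_preserving (fun p => (p.2, p.1)).
Proof.
have mT : measurable_fun setT (fun p : plane => (p.2, p.1) : plane).
  exact: measurable_swap.
split=> // A mA.
apply/esym.
apply: (@product_measure_unique _ _ _ _ _ mu mu
  (pushforward leb2 (fun p : plane => (p.2, p.1) : plane))) => //.
move=> B C mB mC; rewrite /pushforward.
transitivity (leb2 (C `*` B)); last first.
  by have /= -> := @product_measure1E _ _ _ _ R mu mu _ _ mC mB; rewrite muleC.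
by congr (leb2 _); apply/seteqP; split => -[x y] [].
Qed.

Lemma leb2_preserving_shear2 (h : R -> R) : measurable_fun setT h ->
  leb2_preserving (fun p => (p.1 + h p.2, p.2)).
Proof.
move=> mh; exact: (leb2_preserving_comp _ _ leb2_preserving_swap
  (leb2_preserving_comp _ _ (leb2_preserving_shear _ mh) leb2_preserving_swap)).
Qed.

Lemma leb2_preserving_translation (a b : R) :
  leb2_preserving (fun p => (p.1 + a, p.2 + b)).
Proof.
exact: (leb2_preserving_comp _ _ (leb2_preserving_shear2 (cst a) (measurable_cst _))
  (leb2_preserving_shear (cst b) (measurable_cst _))).
Qed.

Let preserving_rotation_generic (c s : R) : c ^+ 2 + s ^+ 2 = 1 -> c != -1 ->
  leb2_preserving (fun p => (p.1 * c - p.2 * s, p.1 * s + p.2 * c)).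
Proof.
(* For a rotation of angle theta, [t] is - tan(theta / 2): the rotation is a horizontal shear by
   [t], a vertical shear by [s], and the horizontal shear by [t] again. *)
move=> cs c1; pose t := - (s / (1 + c)).
have mM (k : R) : measurable_fun setT (fun x : R => x * k).
  exact: measurable_funM.
have := leb2_preserving_comp _ _ (leb2_preserving_shear2 _ (mM t))
  (leb2_preserving_comp _ _ (leb2_preserving_shear _ (mM s))
    (leb2_preserving_shear2 _ (mM t))).
congr leb2_preserving; apply/funext => -[x y] /=; rewrite /t.
have c0 : 1 + c != 0 by apply: contra c1 => /eqP c0; apply/eqP; lra.
have ss : s ^+ 2 = (1 - c) * (1 + c) by rewrite -[1]cs; nra.
have st : s * (s / (1 + c)) = 1 - c by rewrite mulrA -expr2 ss mulfK.
congr pair.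
  transitivity (x - y * (s / (1 + c)) - x * (s * (s / (1 + c))) +
    y * (s * (s / (1 + c))) * (s / (1 + c)) - y * (s / (1 + c))); first by ring.
  by rewrite st; field.
transitivity (y + x * s - y * (s * (s / (1 + c)))); first by ring.
by rewrite st; ring.
Qed.

(* A rotation of angle different from pi is a product of three shears. *)
Lemma leb2_preserving_rotation (c s : R) : c ^+ 2 + s ^+ 2 = 1 ->
  leb2_preserving (fun p => (p.1 * c - p.2 * s, p.1 * s + p.2 * c)).
Proof.
move=> cs; have [c1|] := eqVneq c (-1); last exact: preserving_rotation_generic.
have s0 : s = 0 by apply/eqP; rewrite -sqrf_eq0; apply/eqP; rewrite c1 in cs; lra.
(* The half turn, where tan(theta / 2) is undefined, is the square of a quarter turn. *)
have quarter : leb2_preserving (fun p => (p.1 * 0 - p.2 * 1, p.1 * 1 + p.2 * 0)).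
  apply: preserving_rotation_generic; first by rewrite expr0n expr1n add0r.
  by rewrite eq_sym oppr_eq0 oner_eq0.
have := leb2_preserving_comp _ _ quarter quarter.
congr leb2_preserving; apply/funext => -[x y] /=; rewrite c1 s0; congr pair; ring.
Qed.

Section integral.
Local Open Scope ereal_scope.
Variables (T : plane -> plane) (pT : leb2_preserving T).

Let ge0_integral_preserving (f : plane -> \bar R) : measurable_fun setT f ->
  (forall p, 0 <= f p) -> \int[leb2]_p f (T p) = \int[leb2]_p f p.
Proof.
have [mT lT] := pT; move=> mf f0.
transitivity (\int[pushforward leb2 T]_p f p).
  by rewrite ge0_integral_pushforward.
by apply: eq_measure_integral => A mA _; exact: lT.
Qed.

Lemma integral_preserving (f : plane -> \bar R) : measurable_fun setT f ->
  \int[leb2]_p f (T p) = \int[leb2]_p f p.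
Proof.
move=> mf; rewrite integralE [RHS]integralE; congr (_ - _).
  rewrite -(ge0_integral_preserving (funepos f)) //; last exact: measurable_funepos.
  by apply: eq_integral => p _; rewrite !funeposE.
rewrite -(ge0_integral_preserving (funeneg f)) //; last exact: measurable_funeneg.
  by apply: eq_integral => p _; rewrite !funenegE.
Qed.

Lemma integrable_preserving (f : plane -> \bar R) : measurable_fun setT f ->
  leb2.-integrable setT f -> leb2.-integrable setT (f \o T).
Proof.
have [mT lT] := pT; move=> mf /integrableP[_ fi]; apply/integrableP; split.
  exact: measurableT_comp.
rewrite [ltLHS](_ : _ = \int[leb2]_p (abse \o f) (T p))// integral_preserving//.
exact: measurableT_comp.
Qed.

End integral.

End plane_measure.

(** * Complex derivatives *)

Section complex_facts.
Context {R : realType}.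
Implicit Types (z w h : R[i]).

Lemma normc_ge0 z : 0 <= normc z.
Proof. by case: z => a b; exact: sqrtr_ge0. Qed.

Lemma sqr_normcE z : normc z ^+ 2 = complex.Re z ^+ 2 + complex.Im z ^+ 2.
Proof. by case: z => a b; rewrite /= sqr_sqrtr// addr_ge0// sqr_ge0. Qed.

Lemma normc_le_add z w : normc (z + w) <= normc z + normc w.
Proof. exact: le_normcD. Qed.

Lemma normc_opp z : normc (- z) = normc z.
Proof. exact: normcN. Qed.

Lemma normc_distC z w : normc (z - w) = normc (w - z).
Proof. by rewrite -normc_opp opprB. Qed.

Lemma normc_le_sub z w : normc (z - w) <= normc z + normc w.
Proof. by rewrite -(normc_opp w) normc_le_add. Qed.

Lemma normc_real (x : R) : normc x%:C = `|x|.
Proof. by rewrite /= expr0n addr0 sqrtr_sqr. Qed.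

Lemma normc_conj z : normc (conjc z) = normc z.
Proof. by case: z => a b; rewrite /= sqrrN. Qed.

Lemma normcX z n : normc (z ^+ n) = normc z ^+ n.
Proof.
by elim: n => [|n IH]; rewrite ?expr0 ?normc1// !exprS normcM IH.
Qed.

Lemma Re_le_normc z : `|complex.Re z| <= normc z.
Proof.
rewrite -(@ler_pXn2r _ 2)// ?nnegrE ?normc_ge0// sqr_normcE real_normK ?num_real//.
by rewrite lerDl sqr_ge0.
Qed.

Lemma Im_le_normc z : `|complex.Im z| <= normc z.
Proof.
rewrite -(@ler_pXn2r _ 2)// ?nnegrE ?normc_ge0// sqr_normcE real_normK ?num_real//.
by rewrite lerDr sqr_ge0.
Qed.

Lemma normc_le_ReIm z : normc z <= `|complex.Re z| + `|complex.Im z|.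
Proof.
rewrite -(@ler_pXn2r _ 2)// ?nnegrE ?normc_ge0 ?addr_ge0// sqr_normcE.
rewrite sqrrD !real_normK ?num_real// lerD2r lerDl.
by rewrite mulrn_wge0// mulr_ge0.
Qed.

Lemma normr_complexE z : `|z| = (normc z)%:C.
Proof. by []. Qed.

(* The derivative expressed with real epsilons, free of the filter and
   algebraic layers on [R[i]]. *)
Definition cderiv (f : R[i] -> R[i]) z l : Prop :=
  forall e : R, 0 < e -> exists2 d : R, 0 < d &
    forall h, normc h < d -> normc (f (z + h) - f z - l * h) <= e * normc h.

Lemma derivable_cderiv f z : derivable f z 1 -> cderiv f z (derive1 f z).
Proof.
move=> df e e0.
have : (fun h => h^-1 *: ((f \o shift z) (h *: (1 : R[i])) - f z)) @ 0^' --> derive1 f z.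
  by rewrite derive1E; exact: df.
move=> /cvgrPdist_le /(_ (e%:C)); rewrite ltcR => /(_ e0).
move=> /nbhs_normP[d /= d0 H].
have [d1 dd1] : exists d1, d = d1%:C by exists (complex.Re d); rewrite RRe_real// gtr0_real.
rewrite dd1 ltcR in d0 H; exists d1 => // h hd.
have [->|h0] := eqVneq h 0.
  by rewrite addr0 subrr mulr0 subr0 normc0 mulr0.
have := H h; rewrite /= sub0r normrN normr_complexE ltcR => /(_ hd h0).
rewrite normr_complexE lecR [h%:A]mulr1 (addrC h) -normc_opp opprB.
set q := (_ - _)%R; move=> qe.
have -> : f (z + h) - f z - derive1 f z * h = q * h.
  rewrite /q mulrBl; congr (_ - _).
  by rewrite -[X in _ = X * h]/(h^-1 * _) mulrAC mulVf// mul1r.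
by rewrite normcM ler_wpM2r// normc_ge0.
Qed.

Lemma cderiv_is_derive f z l : cderiv f z l -> is_derive z (1 : R[i]) f l.
Proof.
move=> fl; have cv : (fun h => h^-1 *: ((f \o shift z) (h *: (1 : R[i])) - f z)) @ 0^' --> l.
  apply/cvgrPdist_le => e e0.
  have [e1 ee1] : exists e1, e = e1%:C by exists (complex.Re e); rewrite RRe_real// gtr0_real.
  rewrite ee1 ltcR in e0 *; have [d d0 H] := fl _ e0.
  apply/nbhs_normP; exists (d%:C); first by rewrite /= ltcR.
  move=> h; rewrite /= sub0r normrN normr_complexE ltcR => hd h0.
  rewrite normr_complexE lecR [h%:A]mulr1 (addrC h) -normc_opp opprB.
  have := H _ hd; set q := (_ - l)%R.
  have -> : f (z + h) - f z - l * h = q * h.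
    rewrite /q mulrBl; congr (_ - _).
  by rewrite -[X in _ = X * h]/(h^-1 * _) mulrAC mulVf// mul1r.
  rewrite normcM ler_pM2r// lt_neqAle normc_ge0 andbT eq_sym.
  by apply: contra h0 => /eqP/eq0_normc ->.
by apply: DeriveDef; [apply/cvg_ex; exists l|exact: cvg_lim cv].
Qed.

Lemma cderiv_derivable f z l : cderiv f z l -> derivable f z 1.
Proof. by move=> /cderiv_is_derive[]. Qed.

Lemma cderiv_derive1 f z l : cderiv f z l -> derive1 f z = l.
Proof. by move=> /cderiv_is_derive[_ <-]; rewrite derive1E. Qed.

Lemma cderiv_unique f z l l' : cderiv f z l -> cderiv f z l' -> l = l'.
Proof. by move=> /cderiv_derive1 <- /cderiv_derive1 <-. Qed.

Lemma entireP f : entire f <-> forall z, exists l, cderiv f z l.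
Proof.
split=> [ef z|ef z]; first by exists (derive1 f z); exact: derivable_cderiv.
by have [l] := ef z; exact: cderiv_derivable.
Qed.

Lemma cderiv_cst (c : R[i]) z : cderiv (fun=> c) z 0.
Proof.
by move=> e e0; exists 1 => // h _; rewrite subrr mul0r subr0 normc0 mulr_ge0 ?normc_ge0 ?ltW.
Qed.

Lemma cderiv_id z : cderiv (fun x => x) z 1.
Proof.
move=> e e0; exists 1 => // h _.
by rewrite mul1r (addrC z) addrK subrr normc0 mulr_ge0 ?normc_ge0 ?ltW.
Qed.

Lemma cderivD f g z l m : cderiv f z l -> cderiv g z m ->
  cderiv (fun x => f x + g x) z (l + m).
Proof.
move=> fl gm e e0; have e20 : 0 < e / 2 by rewrite divr_gt0.
have [d d0 fd] := fl _ e20; have [d' d'0 gd] := gm _ e20.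
exists (Order.min d d'); first by rewrite lt_min d0.
move=> h; rewrite lt_min => /andP[/fd fh /gd gh].
rewrite [X in normc X](_ : _ = (f (z + h) - f z - l * h) + (g (z + h) - g z - m * h)); last by ring.
by rewrite (le_trans (normc_le_add _ _))// (le_trans (lerD fh gh))// -mulrDl -splitr.
Qed.

Lemma cderiv_continuous f z l : cderiv f z l ->
  forall e : R, 0 < e -> exists2 d : R, 0 < d &
    forall h, normc h < d -> normc (f (z + h) - f z) <= e.
Proof.
move=> fl e e0; have [d d0 fd] := fl _ ltr01.
have K0 : 0 < 1 + normc l by rewrite ltr_pwDl// normc_ge0.
exists (Order.min d (e / (1 + normc l))); first by rewrite lt_min d0 divr_gt0.
move=> h; rewrite lt_min ltr_pdivlMr// => /andP[/fd fh he].
rewrite [X in normc X](_ : _ = (f (z + h) - f z - l * h) + l * h); last by ring.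
rewrite (le_trans (normc_le_add _ _))// (le_trans (lerD fh (lexx _)))//.
by rewrite normcM -mulrDl mulrC ltW.
Qed.

Lemma cderiv_comp f g z l m : cderiv f (g z) l -> cderiv g z m ->
  cderiv (fun x => f (g x)) z (l * m).
Proof.
move=> fl gm e e0.
have K0 : 0 < 1 + normc m by rewrite ltr_pwDl// normc_ge0.
have L0 : 0 < 1 + normc l by rewrite ltr_pwDl// normc_ge0.
have e1 : 0 < e / 2 / (1 + normc m) by rewrite !divr_gt0.
have e2 : 0 < e / 2 / (1 + normc l) by rewrite !divr_gt0.
have [d d0 fd] := fl _ e1; have [d1 d10 gd1] := gm _ ltr01.
have [d2 d20 gd2] := gm _ e2.
exists (Order.min (Order.min d1 d2) (d / (1 + normc m))).
  by rewrite !lt_min d10 d20 divr_gt0.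
move=> h; rewrite !lt_min ltr_pdivlMr// => /andP[/andP[/gd1 h1 /gd2 h2] hd].
set k := g (z + h) - g z.
have kh : normc k <= (1 + normc m) * normc h.
  rewrite [X in normc X](_ : _ = (g (z + h) - g z - m * h) + m * h); last by rewrite /k; ring.
  rewrite (le_trans (normc_le_add _ _))// (le_trans (lerD h1 (lexx _)))//.
  by rewrite normcM -mulrDl.
have kd : normc k < d by rewrite (le_lt_trans kh)// mulrC.
have := fd _ kd.
rewrite (_ : g z + k = g (z + h)); last by rewrite /k addrC subrK.
move=> fk.
rewrite [X in normc X](_ : _ = (f (g (z + h)) - f (g z) - l * k) +
  l * (g (z + h) - g z - m * h)); last by rewrite /k; ring.
rewrite (le_trans (normc_le_add _ _))// normcM (splitr e) mulrDl lerD//.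
  rewrite (le_trans fk)// -mulrA ler_pM2l ?divr_gt0// mulrC ler_pdivrMr//.
  by rewrite mulrC.
apply: (le_trans (ler_wpM2l (normc_ge0 _) h2)).
rewrite mulrA ler_wpM2r ?normc_ge0// mulrCA ler_piMr//; first by rewrite ltW// divr_gt0.
by rewrite ler_pdivrMr// mul1r lerDr.
Qed.

(** By polarization, f g = ((f + g)^2 - f^2 - g^2) / 2, so the product rule follows from the chain
    rule applied to squaring and to multiplication by constants. *)
Lemma cderivM f g z l m : cderiv f z l -> cderiv g z m ->
  cderiv (fun x => f x * g x) z (l * g z + f z * m).
Proof.
move=> fl gm e e0.
have sq (u : R[i]) : cderiv (fun x => x * x) u (u + u).
  move=> e' e'0; exists e' => // h /ltW he.
  rewrite [X in normc X](_ : _ = h * h); last by ring.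
  by rewrite normcM ler_wpM2r// normc_ge0.
have cM (c : R[i]) k u n : cderiv k u n -> cderiv (fun x => c * k x) u (c * n).
  move=> kn; apply: (cderiv_comp (fun x => c * x) k) => //.
  move=> e' e'0; exists 1 => // h _.
  rewrite [X in normc X](_ : _ = 0); last by ring.
  by rewrite normc0 mulr_ge0 ?normc_ge0 ?ltW.
have := cderivD _ _ _ _ _ (cM 2^-1 _ _ _ (cderiv_comp _ _ _ _ _ (sq _) (cderivD _ _ _ _ _ fl gm)))
  (cM (- 2^-1) _ _ _ (cderivD _ _ _ _ _ (cderiv_comp _ _ _ _ _ (sq _) fl)
    (cderiv_comp _ _ _ _ _ (sq _) gm))).
have n2 : (2 : R[i]) != 0 by rewrite pnatr_eq0.
rewrite (_ : (fun x => _) = (fun x => f x * g x)); last by apply/funext => x; field.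
rewrite (_ : _ + _ = l * g z + f z * m); last by field.
by apply.
Qed.

End complex_facts.

(** * The complex exponential *)

Section complex_exponential.
Context {R : realType}.
Implicit Types (z w h : R[i]) (x y : R).

(** The mean value theorem between 0 and [x] for either sign of [x]. Only the size of the
    intermediate point is kept, which is all that the remainder estimates below use. *)
Let mean_value (f g : R -> R) x : (forall t, is_derive t (1 : R) f (g t)) ->
  exists2 c, `|c| <= `|x| & f x - f 0 = g c * x.
Proof.
move=> fg.
have cf : continuous f.
  by move=> t; apply/differentiable_continuous/derivable1_diffP; have [] := fg t.
have [x0|x0] := leP 0 x.
  have [c] := @MVT_segment R f g 0 x x0 (fun t _ => fg t) (continuous_subspaceT cf).
  rewrite in_itv/= => /andP[c0 cx] ->; exists c; last by rewrite subr0.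
  by rewrite !ger0_norm.
have [c] := @MVT_segment R f g x 0 (ltW x0) (fun t _ => fg t) (continuous_subspaceT cf).
rewrite in_itv/= => /andP[xc c0] E; exists c; first by rewrite (ltr0_norm x0) ler0_norm// lerN2.
by rewrite -[LHS]opprB E sub0r mulrN opprK.
Qed.

Lemma norm_sin_le x : `|sin x| <= `|x|.
Proof.
have [c _] := mean_value sin cos x (fun=> is_derive_sin _).
rewrite sin0 subr0 => ->; rewrite normrM ler_piMl//.
by rewrite ler_norml cos_geN1 cos_le1.
Qed.

Lemma norm_cosB1_le x : `|cos x - 1| <= x ^+ 2.
Proof.
have [c cx] := mean_value cos (fun t => - sin t) x (fun=> is_derive_cos _).
rewrite cos0 => ->; rewrite normrM normrN -[x ^+ 2]real_normK ?num_real// expr2 ler_wpM2r//.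
exact: le_trans (norm_sin_le _) cx.
Qed.

Lemma norm_cosB1_le1 x : `|cos x - 1| <= `|x|.
Proof.
have [c cx] := mean_value cos (fun t => - sin t) x (fun=> is_derive_cos _).
rewrite cos0 => ->; rewrite normrM normrN ler_piMl//.
by rewrite ler_norml sin_geN1 sin_le1.
Qed.

Lemma norm_sinBid_le x : `|sin x - x| <= x ^+ 2.
Proof.
have dsin (t : R) : is_derive t (1 : R) (fun t => sin t - t) (cos t - 1).
  exact: is_deriveB.
have [c cx] := mean_value _ _ x dsin.
rewrite sin0 !subr0 => ->; rewrite normrM -[x ^+ 2]real_normK ?num_real// expr2 ler_wpM2r//.
exact: le_trans (norm_cosB1_le1 _) cx.
Qed.

(** Two mean values: exp x - 1 - x = (exp c - 1) x = exp(d) c x with |d| <= |c| <= |x|. *)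
Lemma norm_expRB1_le x : `|expR x - 1 - x| <= x ^+ 2 * expR `|x|.
Proof.
have dexp (t : R) : is_derive t (1 : R) (fun t => expR t - t) (expR t - 1).
  exact: is_deriveB.
have [c cx] := mean_value _ _ x dexp.
rewrite expR0 subr0 addrAC => ->.
have [d dc] := mean_value _ _ c (fun=> is_derive_expR _).
rewrite expR0 => ->; rewrite !normrM -[x ^+ 2]real_normK ?num_real// expr2 mulrC mulrA mulrAC.
rewrite ler_pM ?mulr_ge0// ?expR_ge0//; first by rewrite ler_wpM2l.
by rewrite (ger0_norm (expR_ge0 _)) ler_expR (le_trans (ler_norm _))// (le_trans dc).
Qed.

Definition cexp z : R[i] :=
  expR (complex.Re z) * cos (complex.Im z) +i* (expR (complex.Re z) * sin (complex.Im z)).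

Lemma cexp0 : cexp 0 = 1.
Proof. by rewrite /cexp/= expR0 cos0 sin0 mulr1 mulr0. Qed.

Lemma cexpD z w : cexp (z + w) = cexp z * cexp w.
Proof.
case: z w => a b [c d]; rewrite /cexp /= expRD cosD sinD.
by apply/eqP; rewrite eq_complex /=; apply/andP; split; apply/eqP; ring.
Qed.

Lemma normc_cexp z : normc (cexp z) = expR (complex.Re z).
Proof.
by rewrite /cexp/= !exprMn -mulrDr cos2Dsin2 mulr1 sqrtr_sqr ger0_norm.
Qed.

Lemma normc_cexp_le z : normc (cexp z) <= expR (normc z).
Proof. by rewrite normc_cexp ler_expR (le_trans (ler_norm _) (Re_le_normc _)). Qed.

Lemma cexp_real x : cexp x%:C = (expR x)%:C.
Proof. by rewrite /cexp/= cos0 sin0 mulr1 mulr0. Qed.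

Lemma conjc_cexp z : conjc (cexp z) = cexp (conjc z).
Proof. by case: z => a b; rewrite /cexp/= cosN sinN mulrN. Qed.

Lemma normc_cexpB1 h :
  normc (cexp h - 1 - h) <= 3 * normc h ^+ 2 * expR (normc h).
Proof.
case: h => x y; set N := normc (x +i* y).
have Nx : `|x| <= N by exact: Re_le_normc (x +i* y).
have Ny : `|y| <= N by exact: Im_le_normc (x +i* y).
have N2 : N ^+ 2 = x ^+ 2 + y ^+ 2 by exact: sqr_normcE.
have E1 : 1 <= expR N by rewrite -expR0 ler_expR (le_trans _ Nx).
(* Each of the four terms is quadratically small by one or two of the real estimates. Together they
   give x^2 + 2 y^2 + 2 |x| |y|, at most 3 (x^2 + y^2), whence the factor 3. *)
rewrite [X in normc X](_ : _ = (expR x - 1 - x)%:C * (cos y +i* sin y) +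
  (cos y - 1)%:C + 'i * (sin y - y)%:C + x%:C * ((cos y - 1) +i* sin y)); last first.
  by apply/eqP; rewrite eq_complex /=; apply/andP; split; apply/eqP; ring.
have cs : normc (cos y +i* sin y) = 1 by rewrite /= cos2Dsin2 sqrtr1.
have n1 : normc ((expR x - 1 - x)%:C * (cos y +i* sin y)) <= x ^+ 2 * expR N.
  rewrite normcM cs mulr1 normc_real (le_trans (norm_expRB1_le _))//.
  by rewrite ler_wpM2l ?sqr_ge0// ler_expR.
have n2 : normc (cos y - 1)%:C <= y ^+ 2 * expR N.
  rewrite normc_real (le_trans (norm_cosB1_le _))// ler_peMr ?sqr_ge0//.
have n3 : normc ('i * (sin y - y)%:C) <= y ^+ 2 * expR N.
  rewrite normcM normc_real [normc 'i]/= expr0n expr1n add0r sqrtr1 mul1r.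
  by rewrite (le_trans (norm_sinBid_le _))// ler_peMr ?sqr_ge0.
have n4 : normc (x%:C * ((cos y - 1) +i* sin y)) <= (2 * `|x| * `|y|) * expR N.
  rewrite normcM normc_real; apply: (@le_trans _ _ (2 * `|x| * `|y|)); last first.
    by rewrite ler_peMr// !mulr_ge0.
  rewrite mulrAC mulrC ler_wpM2r// (le_trans (normc_le_ReIm _))//=.
  by rewrite mulrDl mul1r lerD// ?norm_cosB1_le1 ?norm_sin_le.
apply: (le_trans (normc_le_add _ _)); apply: (le_trans (lerD (normc_le_add _ _) n4)).
apply: (le_trans (lerD (lerD (normc_le_add _ _) n3) (lexx _))).
apply: (le_trans (lerD (lerD (lerD n1 n2) (lexx _)) (lexx _))).
rewrite -!mulrDl ler_wpM2r ?expR_ge0// N2.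
have := sqr_ge0 (`|x| - `|y|); rewrite sqrrB !real_normK ?num_real// => xy.
have := sqr_ge0 x; rewrite -mulrA (mulr_natl (_ * _) 2); lra.
Qed.

Lemma cderiv_cexp z : cderiv cexp z (cexp z).
Proof.
move=> e e0; have K0 : 0 < 3 * expR (complex.Re z) * expR 1 :> R by rewrite !mulr_gt0// expR_gt0.
exists (Order.min 1 (e / (3 * expR (complex.Re z) * expR 1))).
  by rewrite lt_min ltr01 divr_gt0.
move=> h; rewrite lt_min ltr_pdivlMr// => /andP[h1 he].
rewrite [X in normc X](_ : _ = cexp z * (cexp h - 1 - h)); last by rewrite cexpD; ring.
rewrite normcM normc_cexp; have := normc_cexpB1 h => H.
apply: (le_trans (ler_wpM2l (expR_ge0 _) H)).
have eh : expR (normc h) <= expR 1 by rewrite ler_expR ltW.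
apply: (@le_trans _ _ (normc h * (3 * expR (complex.Re z) * expR 1) * normc h)); last first.
  by rewrite ler_wpM2r ?normc_ge0// ltW.
rewrite [leRHS](_ : _ = expR (complex.Re z) * (3 * normc h ^+ 2 * expR 1)); last by ring.
by rewrite ler_wpM2l ?expR_ge0// ler_wpM2l// mulr_ge0// sqr_ge0.
Qed.

End complex_exponential.

(** * Goursat's lemma and mean values *)

Section goursat.
Context {R : realType}.
Local Notation mu := (@lebesgue_measure R).
Implicit Types (x y s t d : R).

Let I (f : R -> R) x y : R := \int[mu]_(s in `[x, y]) f s.

Lemma integrable_segment (f : R -> R) x y : continuous f ->
  mu.-integrable `[x, y] (EFin \o f).
Proof.
move=> cf; apply: continuous_compact_integrable; first exact: segment_compact.
exact: continuous_subspaceT.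
Qed.

Let I_split (f : R -> R) x d : continuous f -> 0 <= d ->
  I f x (x + (d + d)) = I f x (x + d) + I f (x + d) (x + (d + d)).
Proof.
move=> cf d0; rewrite /I.
have le1 : x + d <= x + (d + d) by rewrite lerD2l lerDl.
have := @Rintegral_itvB R f (BLeft x) (BRight (x + (d + d))) (x + d) (integrable_segment _ _ _ cf).
rewrite !bnd_simp lerDl => /(_ d0 le1).
rewrite Rintegral_itv_obnd_cbnd; last first.
  apply: (@integrableS _ _ _ mu `[x + d, x + (d + d)]) ;
    [by []|by []|exact: subset_itv_oc_cc|exact: integrable_segment].
by move=> <-; rewrite subrKC.
Qed.

Lemma segment_integral_dist (f : R -> R) x d c K : continuous f -> 0 <= d ->
  (forall s, x <= s <= x + d -> `|f s - c| <= K) ->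
  `|I f x (x + d) - c * d| <= K * d.
Proof.
move=> cf d0 fK.
have mu_seg : fine (mu `[x, x + d]) = d.
  rewrite lebesgue_measure_itv/= lte_fin ltrDl; case: ltP => [_|d1] /=.
    by rewrite addrAC subrr add0r.
  by apply/eqP; rewrite eq_le d0.
have cst_int k : I (fun=> k) x (x + d) = k * d.
  by rewrite /I Rintegral_cst//; congr (_ * _); exact: mu_seg.
have le_int (k l : R) (g h : R -> R) : continuous g -> continuous h ->
    (forall s, x <= s <= x + d -> g s <= h s) -> I g x (x + d) <= I h x (x + d).
  by move=> cg ch gh; apply: le_Rintegral => //; exact: integrable_segment.
have ck (k : R) : continuous (fun _ : R => k) by move=> ?; exact: cvg_cst.
have lo : (c - K) * d <= I f x (x + d).
  by rewrite -cst_int; apply: le_int => // s /fK; rewrite ler_distl => /andP[].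
have hi : I f x (x + d) <= (c + K) * d.
  by rewrite -cst_int; apply: le_int => // s /fK; rewrite ler_distl => /andP[].
by rewrite ler_distl -mulrBl -mulrDl lo hi.
Qed.

Variable H : R[i] -> R[i].
Hypothesis Hd : forall z, exists l, cderiv H z l.

Let u s t := complex.Re (H (s +i* t)).
Let v s t := complex.Im (H (s +i* t)).

Let normc_re x : normc (x +i* 0) = `|x|. Proof. exact: normc_real. Qed.
Let normc_im x : normc (0 +i* x) = `|x|.
Proof. by rewrite /= expr0n add0r sqrtr_sqr. Qed.

Let continuous_u t : continuous (u ^~ t).
Proof.
move=> s; apply/cvgrPdist_le => e e0; have [l Hl] := Hd (s +i* t).
have [d d0 dP] := cderiv_continuous _ _ _ Hl _ e0.
apply/nbhs_normP; exists d => // s' /=; rewrite distrC => ss'; rewrite distrC.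
have := dP ((s' - s) +i* 0); rewrite normc_re => /(_ ss').
rewrite [X in H X](_ : _ = s' +i* t); last first.
  by apply/eqP; rewrite eq_complex/= addr0 addrC subrK !eqxx.
apply: le_trans; rewrite /u; apply: le_trans (Re_le_normc _).
by case: (H _) (H _) => a b [].
Qed.

Lemma continuous_Im_vertical s : continuous (v s).
Proof.
move=> t; apply/cvgrPdist_le => e e0; have [l Hl] := Hd (s +i* t).
have [d d0 dP] := cderiv_continuous _ _ _ Hl _ e0.
apply/nbhs_normP; exists d => // t' /=; rewrite distrC => ss'; rewrite distrC.
have := dP (0 +i* (t' - t)); rewrite normc_im => /(_ ss').
rewrite [X in H X](_ : _ = s +i* t'); last first.
  by apply/eqP; rewrite eq_complex/= addr0 [t + _]addrC subrK !eqxx.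
apply: le_trans; rewrite /v; apply: le_trans (Im_le_normc _).
by case: (H _) (H _) => a b [].
Qed.

(* The real part of the integral of [H] along the boundary of the square of
   side [d] with lower left corner [x + iy]. *)
Let boundary x y d : R :=
  I (u ^~ y) x (x + d) - I (u ^~ (y + d)) x (x + d)
  - I (v (x + d)) y (y + d) + I (v x) y (y + d).

Let boundary_split x y d : 0 <= d -> boundary x y (d + d) =
  boundary x y d + boundary (x + d) y d + boundary x (y + d) d + boundary (x + d) (y + d) d.
Proof.
move=> d0; rewrite /boundary -!addrA.
have Iu t a := I_split (u ^~ t) a d (continuous_u t) d0.
have Iv s b := I_split (v s) b d (continuous_Im_vertical s) d0.
rewrite !Iu !Iv.
ring.
Qed.

(** Near x + iy the function is affine up to a small multiple of [d]. The constant part cancels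
    between opposite sides. The linear part with coefficient [l] contributes Im(l) d^2 through the
    horizontal sides and the same amount, with opposite sign, through the vertical ones. Only the
    remainder is left. *)
Let boundary_local (x y e : R) : 0 < e -> exists2 d0 : R, 0 < d0 &
  forall x' y' d, 0 <= d < d0 -> x' <= x <= x' + d -> y' <= y <= y' + d ->
    `|boundary x' y' d| <= e * d ^+ 2.
Proof.
move=> e0; have [l Hl] := Hd (x +i* y).
(* Points of the square lie within 2 d of x + iy, so the remainder is at most (e / 8) (2 d). It
   enters through two sides in each direction, for a total of e d on a length d. The radius [D / 2]
   keeps 2 d below [D]. *)
have e8 : 0 < e / 8 by rewrite divr_gt0.
have [D D0 HD] := Hl _ e8; exists (D / 2); first by rewrite divr_gt0.
move=> x' y' d /andP[d0 dD] /andP[xx xd] /andP[yy yd].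
pose r s t := H (s +i* t) - H (x +i* y) - l * ((s - x) +i* (t - y)).
have rP s t : x' <= s <= x' + d -> y' <= t <= y' + d -> normc (r s t) <= e / 4 * d.
  move=> /andP[s1 s2] /andP[t1 t2].
  have hd : normc ((s - x) +i* (t - y)) <= 2 * d.
    apply: (le_trans (normc_le_ReIm _)); rewrite /= mulr_natl mulr2n.
    by rewrite lerD// ler_norml; apply/andP; split; lra.
  have := HD ((s - x) +i* (t - y)); rewrite (le_lt_trans hd); last by lra.
  rewrite [X in H X](_ : _ = s +i* t); last first.
    by apply/eqP; rewrite eq_complex/=; apply/andP; split; apply/eqP; ring.
  move=> /(_ isT) /le_trans; apply.
  rewrite (_ : e / 4 * d = e / 8 * (2 * d)); last by field.
  by rewrite ler_pM2l.
have keyu (A B P m : R[i]) (a b1 b2 : R) : complex.Re A - complex.Re B - complex.Im m * (b2 - b1) =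
    complex.Re ((A - P - m * (a +i* b1)) - (B - P - m * (a +i* b2))).
  by case: A B P m => a0 b0 [a3 b3] [a4 b4] [a5 b5] /=; ring.
have keyv (A B P m : R[i]) (a1 a2 b1 : R) : complex.Im A - complex.Im B - complex.Im m * (a1 - a2) =
    complex.Im ((A - P - m * (a1 +i* b1)) - (B - P - m * (a2 +i* b1))).
  by case: A B P m => a0 b0 [a3 b3] [a4 b4] [a5 b5] /=; ring.
pose b := complex.Im l.
have xs : x' <= x' <= x' + d by rewrite lexx lerDl.
have xs' : x' <= x' + d <= x' + d by rewrite lexx lerDl d0.
have ys : y' <= y' <= y' + d by rewrite lexx lerDl.
have ys' : y' <= y' + d <= y' + d by rewrite lexx lerDl d0.
have ub s : x' <= s <= x' + d -> `|u s y' - u s (y' + d) - b * d| <= e / 2 * d.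
  move=> sx; rewrite (_ : _ - _ = complex.Re (r s y' - r s (y' + d))); last first.
    rewrite /r -keyu /u /b; congr (_ - _ * _); ring.
  apply: (le_trans (Re_le_normc _)); apply: (le_trans (normc_le_sub _ _)).
  apply: (le_trans (lerD (rP _ _ sx ys) (rP _ _ sx ys'))); lra.
have vb t : y' <= t <= y' + d -> `|v (x' + d) t - v x' t - b * d| <= e / 2 * d.
  move=> ty; rewrite (_ : _ - _ = complex.Im (r (x' + d) t - r x' t)); last first.
    rewrite /r -keyv /v /b; congr (_ - _ * _); ring.
  apply: (le_trans (Im_le_normc _)); apply: (le_trans (normc_le_sub _ _)).
  apply: (le_trans (lerD (rP _ _ xs' ty) (rP _ _ xs ty))); lra.
have cu : continuous (fun s => u s y' - u s (y' + d)).
  by move=> s; apply: cvgB; exact: continuous_u.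
have cv : continuous (fun t => v (x' + d) t - v x' t).
  by move=> s; apply: cvgB; exact: continuous_Im_vertical.
have Iu := segment_integral_dist _ _ _ _ _ cu d0 ub.
have Iv := segment_integral_dist _ _ _ _ _ cv d0 vb.
have -> : boundary x' y' d = I (fun s => u s y' - u s (y' + d)) x' (x' + d)
    - I (fun t => v (x' + d) t - v x' t) y' (y' + d).
  have iu t := integrable_segment (u ^~ t) x' (x' + d) (continuous_u t).
  have iv s := integrable_segment (v s) y' (y' + d) (continuous_Im_vertical s).
  rewrite /boundary /I (RintegralB _ (iu _) (iu _))// (RintegralB _ (iv _) (iv _))//.
  ring.
move: Iu Iv; set A := I _ _ _; set B := I _ _ _ => Iu Iv.
rewrite (_ : A - B = (A - b * d * d) - (B - b * d * d)); last by ring.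
rewrite (le_trans (ler_normB _ _))// (le_trans (lerD Iu Iv))//.
by rewrite expr2; lra.
Qed.

Let nested_intervals (x d : nat -> R) : (forall n, 0 <= d n) ->
  (forall n, x n <= x n.+1 /\ x n.+1 + d n.+1 <= x n + d n) ->
  exists c, forall n, x n <= c <= x n + d n.
Proof.
move=> d0 xd.
have mx m n : (m <= n)%N -> x m <= x n /\ x n + d n <= x m + d m.
  elim: n => [|n IH]; first by rewrite leqn0 => /eqP ->.
  rewrite leq_eqVlt => /orP[/eqP ->//|/IH[h1 h2]]; have [h3 h4] := xd n.
  by split; [exact: le_trans h1 h3|exact: le_trans h4 h2].
have ubx n : ubound (range x) (x n + d n).
  move=> _ [m _ <-]; have [mn|/ltnW nm] := leqP m n.
    have [h _] := mx _ _ mn; rewrite (le_trans h)// lerDl//.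
  by have [_ h] := mx _ _ nm; rewrite (le_trans _ h)// lerDl.
exists (sup (range x)) => n; apply/andP; split.
  by apply: ub_le_sup; [exists (x 0%N + d 0%N); exact: ubx|exists n].
by apply: ge_sup; [exists (x 0%N), 0%N|exact: ubx].
Qed.

(** Bisection: if the boundary integral exceeds [e] times the area, it does so for one of the four
    quarters. The squares obtained shrink to a point, where [boundary_local] forbids this. *)
Lemma goursat_square x y : boundary x y 1 = 0.
Proof.
apply/eqP; rewrite -normr_eq0 eq_le normr_ge0 andbT; apply/ler_addgt0Pl => e e0.
rewrite addr0 leNgt; apply/negP => big.
pose bad (p : R * R * R) := 0 <= p.2 /\ e * p.2 ^+ 2 < `|boundary p.1.1 p.1.2 p.2|.
(* The hypothesis [bad p] stands inside the existential so that choice yields a total function to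
   iterate; on a square that is not bad, the witness is arbitrary. *)
have : forall p, exists q : R * R * R, bad p ->
    [/\ bad q, q.2 = p.2 / 2, p.1.1 <= q.1.1 /\ q.1.1 + q.2 <= p.1.1 + p.2 &
        p.1.2 <= q.1.2 /\ q.1.2 + q.2 <= p.1.2 + p.2].
  move=> [[a b] D]; have [[D0 /= bD]|nb] := pselect (bad (a, b, D)); last by exists (a, b, D).
  pose d := D / 2; have d0 : 0 <= d by rewrite divr_ge0.
  have DE : D = d + d by rewrite /d; field.
  move: bD; rewrite DE boundary_split// => bD.
  have [h1|h1] := ltP (e * d ^+ 2) `|boundary a b d|.
    by exists (a, b, d) => _; split=> //=; [rewrite -DE|split=> //; lra..].
  have [h2|h2] := ltP (e * d ^+ 2) `|boundary (a + d) b d|.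
    by exists (a + d, b, d) => _; split=> //=; [rewrite -DE|split=> //; lra..].
  have [h3|h3] := ltP (e * d ^+ 2) `|boundary a (b + d) d|.
    by exists (a, b + d, d) => _; split=> //=; [rewrite -DE|split=> //; lra..].
  have [h4|h4] := ltP (e * d ^+ 2) `|boundary (a + d) (b + d) d|.
    by exists (a + d, b + d, d) => _; split=> //=; [rewrite -DE|split=> //; lra..].
  exfalso; move: bD; apply/negP; rewrite -leNgt.
  apply: (le_trans (ler_normD _ _)); apply: (le_trans (lerD (ler_normD _ _) (lexx _))).
  apply: (le_trans (lerD (lerD (ler_normD _ _) (lexx _)) (lexx _))).
  by apply: (le_trans (lerD (lerD (lerD h1 h2) h3) h4)); lra.
move=> /choice[f fP].
pose p n := iter n f (x, y, 1).
have pbad n : bad (p n).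
  elim: n => [|n IH]; last by have [] := fP _ IH.
  by split => //=; rewrite expr1n mulr1.
have pd n : (p n).2 = 2^-1 ^+ n.
  elim: n => [|n IH]; first by rewrite expr0.
  by have [_ -> _ _] := fP _ (pbad n); rewrite IH exprSr.
have d0 n : 0 <= (p n).2 by have [] := pbad n.
have [cx cxP] := nested_intervals (fun n => (p n).1.1) _ d0
  (fun n => let: And4 _ _ h _ := fP _ (pbad n) in h).
have [cy cyP] := nested_intervals (fun n => (p n).1.2) _ d0
  (fun n => let: And4 _ _ _ h := fP _ (pbad n) in h).
(* The point cx + i cy belongs to all the squares, whose sides 2^-n eventually fall below [D]. *)
have [D D0 DP] := boundary_local cx cy _ e0.
have [n nD] : exists n, (p n).2 < D.
  have := @cvg_expr R 2^-1; rewrite ger0_norm// invf_lt1// ltr1n => /(_ isT).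
  move=> /cvgrPdist_lt /(_ _ D0)[n _ /(_ n (leqnn n))].
  by rewrite sub0r normrN ger0_norm ?exprn_ge0// -pd => ?; exists n.
have [_] := pbad n; apply/negP; rewrite -leNgt.
by apply: DP => //; rewrite d0.
Qed.

(** On each unit square between heights 0 and 1 the horizontal sides cancel by periodicity, so
    vanishing of the boundary integral equates the two vertical sides. *)
Lemma periodic_mean x n : (forall s t, H (s +i* (t + 1)) = H (s +i* t)) ->
  \int[mu]_(t in `[0, 1]) complex.Im (H (x +i* t)) =
  \int[mu]_(t in `[0, 1]) complex.Im (H ((x - n%:R) +i* t)).
Proof.
move=> per; elim: n => [|n ->]; first by rewrite subr0.
have := goursat_square (x - n.+1%:R) 0; rewrite /boundary /I.
have -> : (u ^~ (0 + 1)) = (u ^~ 0) by apply/funext => s; rewrite /u per.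
rewrite subrr sub0r add0r addrC => /eqP; rewrite subr_eq0 => /eqP ->.
by rewrite -natr1 opprD addrA subrK.
Qed.

End goursat.

(** * Means over circles centered at 0 *)

Section circle_mean.
Context {R : realType}.
Local Notation mu := (@lebesgue_measure R).
Variables (F : R[i] -> R[i]) (w : R[i]).
Hypothesis entireF : entire F.

(* In the logarithmic coordinate [z] the circles centered at 0 become vertical
   segments of length 1. *)
Let H z := 'i * F (w * cexp ((2 * pi)%:C * z)).

Let Hd z : exists l, cderiv H z l.
Proof.
have [l Fl] := (entireP F).1 entireF (w * cexp ((2 * pi)%:C * z)).
have dlin (a u : R[i]) : cderiv (fun x => a * x) u a.
  have := cderivM _ _ _ _ _ (cderiv_cst a u) (cderiv_id u).
  by rewrite mul0r add0r mulr1.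
eexists; apply: (cderiv_comp (fun x => 'i * x)); first exact: dlin.
apply: (cderiv_comp F (fun x => w * cexp ((2 * pi)%:C * x))) Fl _.
apply: (cderiv_comp (fun x => w * x)); first exact: dlin.
exact: (cderiv_comp cexp) (cderiv_cexp _) (dlin _ _).
Qed.

(** This is the purpose of the factor ['i] in [H]: vertical sides carry imaginary parts in
    [boundary], while the mean wanted is that of Re F. *)
Let ImH z : complex.Im (H z) = complex.Re (F (w * cexp ((2 * pi)%:C * z))).
Proof. by rewrite /H; case: (F _) => a b /=; ring. Qed.

Let HE (t : R) : complex.Im (H (0 +i* t)) =
  complex.Re (F (w * (cos (2 * pi * t) +i* sin (2 * pi * t)))).
Proof.
by rewrite ImH /cexp /= !mulr0 !mul0r subr0 expR0 !mul1r addr0.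
Qed.

Lemma circle_continuous : continuous (fun t : R =>
  complex.Re (F (w * (cos (2 * pi * t) +i* sin (2 * pi * t))))).
Proof.
rewrite (_ : (fun t => _) = (fun t => complex.Im (H (0 +i* t)))).
  exact: (continuous_Im_vertical H Hd).
by apply/funext => t; rewrite HE.
Qed.

Lemma circle_mean : \int[mu]_(t in `[0, 1])
    complex.Re (F (w * (cos (2 * pi * t) +i* sin (2 * pi * t)))) = complex.Re (F 0).
Proof.
have per s t : H (s +i* (t + 1)) = H (s +i* t).
  rewrite /H; congr ('i * F (w * _)).
  rewrite (_ : (2 * pi)%:C * (s +i* (t + 1)) =
    (2 * pi)%:C * (s +i* t) + (0 +i* (pi *+ 2))); last first.
    by apply/eqP; rewrite eq_complex /=; apply/andP; split; apply/eqP; ring.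
  rewrite cexpD [X in _ * X](_ : _ = 1) ?mulr1//.
  by rewrite /cexp/= expR0 cos2pi sin2pi mulr1 mulr0.
under eq_Rintegral do rewrite -HE.
apply/eqP; rewrite -subr_eq0 -normr_eq0 eq_le normr_ge0 andbT.
apply/ler_addgt0Pl => e e0; rewrite addr0.
have [l Fl] := (entireP F).1 entireF 0.
have [d d0 dP] := cderiv_continuous _ _ _ Fl _ e0.
(* Moving [n] units to the left gives the circle this radius. Any n > |w| / d works, since exp(2 pi
   n) >= 1 + 2 pi n >= n. *)
have [n nP] : exists n : nat, normc w * expR (- (2 * pi * n%:R)) < d.
  pose k := normc w / d; exists (Num.truncn k).+1.
  have kn : k < (Num.truncn k).+1%:R by exact: truncnS_gt.
  rewrite expRN ltr_pdivrMr ?expR_gt0// mulrC -ltr_pdivrMr// -/k.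
  apply: (lt_le_trans kn); apply: le_trans (expR_ge1Dx _).
  have p1 : 1 <= 2 * pi :> R by have := @pi_ge2 R; lra.
  by rewrite ler_wpDl// ler_peMl.
rewrite (periodic_mean H Hd 0 n per) sub0r.
have cH : continuous (fun t : R => complex.Im (H (- n%:R +i* t))).
  exact: (continuous_Im_vertical H Hd).
have := segment_integral_dist _ 0 1 (complex.Re (F 0)) e cH ler01.
rewrite add0r !mulr1; apply => t _; rewrite ImH.
have := dP (w * cexp ((2 * pi)%:C * (- n%:R +i* t))); rewrite add0r.
move=> H0; have {}H0 := H0 _.
apply: le_trans (H0 _).
  by apply: le_trans (Re_le_normc _); case: (F _) (F 0) => a b [].
rewrite normcM normc_cexp /= mul0r subr0 mulrN; exact: nP.
Qed.

End circle_mean.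

(** * Gaussian means over the plane by averaging over rotations *)

Section area_mean.
Context {R : realType}.
Local Notation plane := (measurableTypeR R * measurableTypeR R)%type.
Local Notation mu := (@lebesgue_measure R).
Local Notation leb2 := (@leb2 R).

Definition gauss2 (p : plane) : R := expR (- normc (cplx p) ^+ 2).

Lemma gauss2_ge0 p : 0 <= gauss2 p. Proof. exact: expR_ge0. Qed.

Lemma gauss2E p : gauss2 p = gauss_fun p.1 * gauss_fun p.2.
Proof. by rewrite /gauss2 sqr_normcE/= opprD expRD. Qed.

Lemma measurable_gauss2 : measurable_fun setT gauss2.
Proof.
rewrite (_ : gauss2 = fun p => gauss_fun p.1 * gauss_fun p.2); last first.
  by apply/funext => p; exact: gauss2E.
apply: measurable_funM.
  exact: measurableT_comp measurable_gauss_fun measurable_fst.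
exact: measurableT_comp measurable_gauss_fun measurable_snd.
Qed.

Lemma integral_gauss2 : (\int[leb2]_p (gauss2 p)%:E = pi%:E)%E.
Proof.
under eq_integral do rewrite gauss2E.
rewrite (@fubini_tonelli1 _ _ _ _ R mu mu)//; last 2 first.
- apply/measurable_EFinP; apply: measurable_funM.
    exact: measurableT_comp measurable_gauss_fun measurable_fst.
  exact: measurableT_comp measurable_gauss_fun measurable_snd.
- by move=> p; rewrite lee_fin mulr_ge0// gauss_fun_ge0.
have mE : measurable_fun setT (fun x : R => (gauss_fun x)%:E).
  by apply/measurable_EFinP; exact: measurable_gauss_fun.
transitivity (\int[mu]_x ((gauss_fun x)%:E * (Num.sqrt pi)%:E))%E.
  apply: eq_integral => x _; rewrite /fubini_F/= -integralT_gauss.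
  rewrite -ge0_integralZl//; last 2 first.
  - by move=> y _; rewrite lee_fin gauss_fun_ge0.
  - by rewrite lee_fin gauss_fun_ge0.
rewrite ge0_integralZr//; last by move=> y _; rewrite lee_fin gauss_fun_ge0.
by rewrite integralT_gauss -EFinM -expr2 sqr_sqrtr// pi_ge0.
Qed.

Let rot (t : R) (p : plane) : plane :=
  (p.1 * cos (2 * pi * t) - p.2 * sin (2 * pi * t),
   p.1 * sin (2 * pi * t) + p.2 * cos (2 * pi * t)).

Let cplx_rot t p :
  cplx (rot t p) = cplx p * (cos (2 * pi * t) +i* sin (2 * pi * t)).
Proof. by apply/eqP; rewrite eq_complex /=; apply/andP; split; apply/eqP; ring. Qed.

Let gauss2_rot t p : gauss2 (rot t p) = gauss2 p.
Proof.
rewrite /gauss2 cplx_rot normcM [X in _ * X](_ : _ = 1) ?mulr1//.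
by rewrite /= cos2Dsin2 sqrtr1.
Qed.

Let measurable_rot : measurable_fun [set: plane * measurableTypeR R] (fun q => rot q.2 q.1).
Proof.
have mc : measurable_fun setT (fun t : R => cos (2 * pi * t)).
  apply: measurableT_comp; last exact: measurable_funM.
  exact: continuous_measurable_fun (@continuous_cos R).
have ms : measurable_fun setT (fun t : R => sin (2 * pi * t)).
  apply: measurableT_comp; last exact: measurable_funM.
  exact: continuous_measurable_fun (@continuous_sin R).
have m2c : measurable_fun [set: plane * measurableTypeR R] (fun q => cos (2 * pi * q.2)).
  exact: measurableT_comp mc measurable_snd.
have m2s : measurable_fun [set: plane * measurableTypeR R] (fun q => sin (2 * pi * q.2)).
  exact: measurableT_comp ms measurable_snd.
have m11 : measurable_fun [set: plane * measurableTypeR R] (fun q => q.1.1).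
  exact: measurableT_comp measurable_fst measurable_fst.
have m12 : measurable_fun [set: plane * measurableTypeR R] (fun q => q.1.2).
  exact: measurableT_comp measurable_snd measurable_fst.
apply/measurable_fun_pairP; split.
  by apply: measurable_funB; apply: measurable_funM.
by apply: measurable_funD; apply: measurable_funM.
Qed.

(* The library's sigma-finite instance on product measures is shadowed by its
   subprobability one, whence this copy of [leb2]. *)
Definition plane_measure : set plane -> \bar R := leb2.
HB.instance Definition _ := Measure.copy plane_measure leb2.

Lemma plane_measure_sigma_finite : sigma_finite setT plane_measure.
Proof.
pose I n : set (measurableTypeR R) := `[- n%:R, n%:R]%classic.
exists (fun n => I n `*` I n).
  apply/esym; rewrite -subTset => -[x y] _.
  exists (Num.truncn (`|x| + `|y|)).+1 => //=.
  have /ltW := truncnS_gt (`|x| + `|y|); set N := _%:R => xyN.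
  by split; rewrite /I/= in_itv/= -ler_norml (le_trans _ xyN)// ?lerDl ?lerDr.
move=> n; split; first by apply: measurableX; exact: measurable_itv.
rewrite /plane_measure /leb2.
have mI : measurable (I n) by exact: measurable_itv.
have /= -> := @product_measure1E _ _ _ _ R mu mu _ _ mI mI.
by rewrite /I lebesgue_measure_itv/=; case: ifPn => _; rewrite ?mul0e// -EFinB -EFinM ltry.
Qed.

HB.instance Definition _ := Measure_isSigmaFinite.Build _ _ _
  plane_measure plane_measure_sigma_finite.

(* The integral is unchanged by a rotation of the integrand; averaging over all
   rotations replaces [F] by its means over circles, which are [F 0]. *)
Lemma area_mean (F : R[i] -> R[i]) : entire F -> cmeasurable F ->
  leb2.-integrable setT (fun p => (complex.Re (F (cplx p)) * gauss2 p)%:E) ->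
  (\int[leb2]_p (complex.Re (F (cplx p)) * gauss2 p)%:E =
   (pi * complex.Re (F 0))%:E)%E.
Proof.
move=> eF [mF _] iF.
pose g p := (complex.Re (F (cplx p)) * gauss2 p)%:E.
have mg : measurable_fun setT g.
  by apply/measurable_EFinP; apply: measurable_funM => //; exact: measurable_gauss2.
pose D : set (measurableTypeR R) := `[0, 1]%classic.
have mD : measurable D by exact: measurable_itv.
(* The indicator restricts the angle to one full turn, so that Fubini applies to a function on the
   whole product space. *)
pose f (q : plane * measurableTypeR R) := (g (rot q.2 q.1) * (\1_D q.2)%:E)%E.
have mf : measurable_fun setT f.
  apply: emeasurable_funM; first exact: measurableT_comp mg measurable_rot.
  apply/measurable_EFinP.
  apply: (@measurableT_comp _ _ _ _ _ _ (\1_D : measurableTypeR R -> R) _ snd);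
    last exact: measurable_snd.
  exact: measurable_indic.
have prot t : leb2_preserving (rot t).
  by apply: leb2_preserving_rotation; exact: cos2Dsin2.
have muD : mu D = 1%E.
  by rewrite /D lebesgue_measure_itv/= lte_fin ltr01 sube0.
have indE (h : R -> \bar R) :
    (\int[mu]_t (h t * (\1_D t)%:E) = \int[mu]_(t in D) h t)%E.
  by rewrite [RHS]integral_mkcond epatch_indic.
have int_cst c : (\int[mu]_t (c * (\1_D t)%:E) = c)%E.
  by rewrite indE integral_cst// -[RHS]mule1; congr (_ * _)%E; exact: muD.
have /integrableP[_ ig] := iF.
have arotp t : (\int[leb2]_p `|g (rot t p)| = \int[leb2]_p `|g p|)%E.
  by apply: (integral_preserving _ (prot t) (abse \o g)); exact: measurableT_comp.
(* Rotations preserve the inner integral of the absolute value, so the iterated integral is just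
   that of |g|. *)
have if_ : (\int[mu]_t \int[plane_measure]_p `|f (p, t)| < +oo)%E.
  rewrite (_ : (fun t => _) = (fun t => (\int[leb2]_p `|g p|) * (\1_D t)%:E))%E.
    by rewrite int_cst.
  apply/funext => t.
  transitivity (\int[leb2]_p (`|g (rot t p)| * (\1_D t)%:E))%E.
    by apply: eq_integral => p _; rewrite /f abseM; congr (_ * _)%E; rewrite /= ger0_norm.
  rewrite -(arotp t); apply: ge0_integralZr.
  - exact: measurableT.
  - by apply: measurableT_comp => //; apply: (measurableT_comp mg); have [] := prot t.
  - by move=> p _; exact: abse_ge0.
  - by rewrite lee_fin.
have {}if_ := (@integrable21ltyP _ _ plane (measurableTypeR R) R plane_measure mu f mf).2 if_.
have := Fubini if_.
have -> : (\int[mu]_t \int[plane_measure]_p f (p, t) = \int[leb2]_p g p)%E.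
  transitivity (\int[mu]_t ((\int[leb2]_p g p) * (\1_D t)%:E))%E; last exact: int_cst.
  apply: eq_integral => t _; rewrite /f/= indicE; case: (t \in D) => /=.
    rewrite mule1 -(integral_preserving _ (prot t) g mg).
    by apply: eq_integral => p _; rewrite mule1.
  by rewrite mule0; apply: integral0_eq => p _; rewrite mule0.
move=> <-.
(* In the other order of integration the Gaussian factor is constant along the circle through [p],
   and the inner integral is a circle mean. *)
transitivity (\int[leb2]_p ((complex.Re (F 0))%:E * (gauss2 p)%:E))%E; last first.
  rewrite integralZl//; first by rewrite integral_gauss2 -EFinM mulrC.
  apply/integrableP; split; first by apply/measurable_EFinP; exact: measurable_gauss2.
  under eq_integral do rewrite gee0_abs ?lee_fin ?gauss2_ge0//.
  by rewrite integral_gauss2 ltry.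
apply: eq_integral => p _; rewrite /f/= indE.
pose k t := complex.Re (F (cplx p * (cos (2 * pi * t) +i* sin (2 * pi * t)))).
have ik : mu.-integrable D (EFin \o k).
  apply: integrable_segment; exact: circle_continuous.
transitivity (\int[mu]_(t in D) ((EFin \o k) t * (gauss2 p)%:E))%E.
  by apply: eq_integral => t _; rewrite /g gauss2_rot cplx_rot EFinM.
rewrite integralZr//; congr (_ * _)%E.
rewrite -(circle_mean F (cplx p) eF) /Rintegral fineK//.
exact: integrable_fin_num.
Qed.

End area_mean.

(** * Gaussian means *)

Section complex_measurable.
Context {R : realType}.
Local Notation plane := (measurableTypeR R * measurableTypeR R)%type.
Implicit Types (F G : R[i] -> R[i]).

Lemma cmeasurable_cst (c : R[i]) : cmeasurable (fun=> c).
Proof. by split; exact: measurable_cst. Qed.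

Lemma cmeasurable_idfun : cmeasurable (fun z : R[i] => z).
Proof. by split; [exact: measurable_fst|exact: measurable_snd]. Qed.

Lemma cmeasurable_conj F : cmeasurable F -> cmeasurable (fun z => conjc (F z)).
Proof.
move=> [mr mi]; split.
  rewrite (_ : (fun p => _) = (fun p => complex.Re (F (cplx p))))//.
  by apply/funext => p; case: (F _).
rewrite (_ : (fun p => _) = (fun p => - complex.Im (F (cplx p)))).
  exact: measurableT_comp.
by apply/funext => p; case: (F _).
Qed.

Lemma cmeasurableD F G : cmeasurable F -> cmeasurable G ->
  cmeasurable (fun z => F z + G z).
Proof.
by move=> mF mG; have := cmeasurable_lin 1 mF mG; rewrite scale1r.
Qed.

Lemma cmeasurableM F G : cmeasurable F -> cmeasurable G ->
  cmeasurable (fun z => F z * G z).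
Proof.
move=> [rF iF] [rG iG]; split.
  rewrite (_ : (fun p => _) = (fun p => complex.Re (F (cplx p)) * complex.Re (G (cplx p))
    - complex.Im (F (cplx p)) * complex.Im (G (cplx p)))).
    by apply: measurable_funB; exact: measurable_funM.
  by apply/funext => p; case: (F _) (G _) => a b [].
rewrite (_ : (fun p => _) = (fun p => complex.Re (F (cplx p)) * complex.Im (G (cplx p))
  + complex.Im (F (cplx p)) * complex.Re (G (cplx p)))).
  by apply: measurable_funD; exact: measurable_funM.
by apply/funext => p; case: (F _) (G _) => a b [].
Qed.

Lemma cmeasurableB F G : cmeasurable F -> cmeasurable G ->
  cmeasurable (fun z => F z - G z).
Proof.
move=> mF mG; have := cmeasurableD _ _ mF (cmeasurableM _ _ (cmeasurable_cst (-1)) mG).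
by congr cmeasurable; apply/funext => z; rewrite mulN1r.
Qed.

Lemma cmeasurableX F n : cmeasurable F -> cmeasurable (fun z => F z ^+ n).
Proof.
move=> mF; elim: n => [|n IH]; first exact: cmeasurable_cst.
rewrite (_ : (fun z => _) = (fun z => F z * F z ^+ n)); first exact: cmeasurableM.
by apply/funext => z; rewrite exprS.
Qed.

Lemma cmeasurable_cexp F : cmeasurable F -> cmeasurable (fun z => cexp (F z)).
Proof.
move=> [rF iF]; split; apply: measurable_funM; apply: measurableT_comp => //.
  exact: continuous_measurable_fun (@continuous_cos R).
exact: continuous_measurable_fun (@continuous_sin R).
Qed.

Lemma cmeasurable_translation F (a : R[i]) : cmeasurable F ->
  cmeasurable (fun z => F (a + z)).
Proof.
move=> [rF iF].
have [mT _] := leb2_preserving_translation (complex.Re a) (complex.Im a).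
have E p : cplx (p.1 + complex.Re a, p.2 + complex.Im a) = a + cplx p.
  by case: a mT => x y _; rewrite /cplx /= addrC (addrC _ y).
split.
  rewrite (_ : (fun p => _) = (fun p => complex.Re (F (cplx p))) \o
    (fun p => (p.1 + complex.Re a, p.2 + complex.Im a))).
    exact: measurableT_comp.
  by apply/funext => p; rewrite /= E.
rewrite (_ : (fun p => _) = (fun p => complex.Im (F (cplx p))) \o
  (fun p => (p.1 + complex.Re a, p.2 + complex.Im a))).
  exact: measurableT_comp.
by apply/funext => p; rewrite /= E.
Qed.

Lemma measurable_normc F : cmeasurable F ->
  measurable_fun setT (fun p : plane => normc (F (cplx p))).
Proof.
move=> [mr mi]; rewrite (_ : (fun p => _) = Num.sqrt \o
  (fun p => complex.Re (F (cplx p)) ^+ 2 + complex.Im (F (cplx p)) ^+ 2)).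
  apply: measurableT_comp; first exact: continuous_measurable_fun (@sqrt_continuous R).
  by apply: measurable_funD; exact: measurable_funX.
by apply/funext => p /=; case: (F _).
Qed.

End complex_measurable.

(** * Real Gaussian means: Cauchy-Schwarz and exponential growth *)

Section gaussian_mean.
Context {R : realType}.
Local Notation plane := (measurableTypeR R * measurableTypeR R)%type.
Local Notation leb2 := (@leb2 R).
Implicit Types (f g : plane -> R) (F G : R[i] -> R[i]).

Definition gintegrable f : Prop :=
  leb2.-integrable setT (fun p => (f p * gauss2 p)%:E).

Definition gmean f : R := pi^-1 * \int[leb2]_p (f p * gauss2 p).

Lemma gintegrable_le f g : measurable_fun setT f ->
  (forall p, `|f p| <= g p) -> gintegrable g -> gintegrable f.
Proof.
move=> mf fg; apply: le_integrable => //.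
  by apply/measurable_EFinP; apply: measurable_funM => //; exact: measurable_gauss2.
move=> p _; rewrite /= lee_fin normrM (ger0_norm (gauss2_ge0 _)).
by rewrite (le_trans _ (ler_norm _))// ler_wpM2r// gauss2_ge0.
Qed.

Lemma gintegrableD f g : gintegrable f -> gintegrable g ->
  gintegrable (fun p => f p + g p).
Proof.
move=> fi gi; have := integrableD measurableT fi gi; apply: eq_integrable => // p _.
by rewrite /= mulrDl EFinD.
Qed.

Lemma gintegrableZ k f : gintegrable f -> gintegrable (fun p => k * f p).
Proof.
move=> fi; have := integrableZl measurableT k fi; apply: eq_integrable => // p _.
by rewrite /= -EFinM mulrA.
Qed.

Lemma gmeanD f g : gintegrable f -> gintegrable g ->
  gmean (fun p => f p + g p) = gmean f + gmean g.
Proof.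
move=> fi gi; rewrite /gmean -mulrDr -(RintegralD measurableT fi gi); congr (_ * _).
by apply: eq_Rintegral => p _; rewrite mulrDl.
Qed.

Lemma gmeanZ k f : gintegrable f -> gmean (fun p => k * f p) = k * gmean f.
Proof.
move=> fi; rewrite /gmean mulrCA -(RintegralZl k measurableT fi); congr (_ * _).
by apply: eq_Rintegral => p _; rewrite mulrA.
Qed.

Lemma gmean_ge0 f : (forall p, 0 <= f p) -> 0 <= gmean f.
Proof.
move=> f0; rewrite mulr_ge0 ?invr_ge0 ?pi_ge0//.
by apply: Rintegral_ge0 => p _; rewrite mulr_ge0// gauss2_ge0.
Qed.

Lemma gmean_le f g : gintegrable f -> gintegrable g ->
  (forall p, f p <= g p) -> gmean f <= gmean g.
Proof.
move=> fi gi fg; rewrite ler_wpM2l ?invr_ge0 ?pi_ge0//.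
by apply: (le_Rintegral measurableT fi gi) => p _; rewrite ler_wpM2r// gauss2_ge0.
Qed.

(** The mean of (t f - g)^2 is a quadratic polynomial in t that is never negative. *)
Lemma gmean_cauchy_schwarz f g :
  gintegrable (fun p => f p ^+ 2) -> gintegrable (fun p => g p ^+ 2) ->
  gintegrable (fun p => f p * g p) ->
  gmean (fun p => f p * g p) <=
    Num.sqrt (gmean (fun p => f p ^+ 2)) * Num.sqrt (gmean (fun p => g p ^+ 2)).
Proof.
move=> ff gg fg; set A := gmean (fun p => f p ^+ 2); set B := gmean (fun p => g p ^+ 2).
set E := gmean _.
have A0 : 0 <= A by apply: gmean_ge0 => p; exact: sqr_ge0.
have B0 : 0 <= B by apply: gmean_ge0 => p; exact: sqr_ge0.
have quad t : 0 <= t ^+ 2 * A - 2 * t * E + B.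
  rewrite -mulNr /A /B /E -!gmeanZ// -!gmeanD//.
  - by apply: gmean_ge0 => p; have := sqr_ge0 (t * f p - g p); congr (_ <= _); ring.
  - by apply: gintegrableD; exact: gintegrableZ.
  - exact: gintegrableZ.
  - exact: gintegrableZ.
have [E0|E0] := leP E 0; first by rewrite (le_trans E0)// mulr_ge0 ?sqrtr_ge0.
have {}A0 : 0 < A.
  rewrite lt_neqAle A0 andbT; apply/eqP => A_0.
  (* With A = 0 the polynomial is affine and takes the value -1 at this point. *)
  have := quad ((B + 1) / (2 * E)).
  rewrite -A_0 mulr0 sub0r (_ : 2 * _ * E = B + 1); last by field; rewrite gt_eqF.
  by rewrite opprD addrAC addNr add0r oppr_ge0 ler10.
rewrite -sqrtrM; last exact: ltW.
rewrite -[leLHS]ger0_norm; last exact: ltW.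
rewrite -sqrtr_sqr ler_wsqrtr//.
(* E / A is the minimizer of the quadratic polynomial. *)
have := quad (E / A); rewrite (_ : _ + B = (A * B - E ^+ 2) / A); last by field; rewrite gt_eqF.
by rewrite pmulr_lge0 ?invr_gt0// subr_ge0.
Qed.

Lemma gauss2_translation (a b : R) (p : plane) :
  gauss2 (p.1 + a, p.2 + b) =
  expR (- (a ^+ 2 + b ^+ 2)) * expR (- 2 * (a * p.1 + b * p.2)) * gauss2 p.
Proof. by rewrite /gauss2 !sqr_normcE/= -!expRD; congr expR; ring. Qed.

(** Completing the square: up to a constant factor the integrand is the Gaussian translated by (- a
    / 2, - b / 2), and translations preserve integrability. *)
Lemma gintegrable_expR_linear (a b : R) :
  gintegrable (fun p => expR (a * p.1 + b * p.2)).
Proof.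
have ig : leb2.-integrable setT (fun p => (gauss2 p)%:E).
  apply/integrableP; split; first by apply/measurable_EFinP; exact: measurable_gauss2.
  under eq_integral do rewrite gee0_abs ?lee_fin ?gauss2_ge0//.
  by rewrite integral_gauss2 ltry.
have mg : measurable_fun setT (fun p : plane => (gauss2 p)%:E).
  by apply/measurable_EFinP; exact: measurable_gauss2.
pose a' := - (a / 2); pose b' := - (b / 2).
have := integrable_preserving _ (leb2_preserving_translation a' b') _ mg ig.
move=> /(integrableZl measurableT (expR (a' ^+ 2 + b' ^+ 2))).
apply: eq_integrable => // p _; rewrite /= gauss2_translation -EFinM !mulrA -expRD.
rewrite subrr expR0 mul1r.
by congr ((expR _ * _)%:E); rewrite /a' /b'; field.
Qed.

(** From |z| <= |x| + |y| and exp(k |x|) <= exp(k x) + exp(- k x), the integrand is dominated by a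
    sum of four exponentials of linear forms. *)
Lemma gintegrable_expR_normc (c : R) : gintegrable (fun p => expR (c * normc (cplx p))).
Proof.
pose k := `|c|.
have kabs (x : R) : expR (k * `|x|) <= expR (k * x) + expR (- k * x).
  case: (leP 0 x) => x0; first by rewrite ger0_norm// lerDl expR_ge0.
  by rewrite ltr0_norm// mulrN -mulNr lerDr expR_ge0.
apply: (@gintegrable_le _ (fun p => (expR (k * p.1 + k * p.2) + expR (k * p.1 + - k * p.2))
    + (expR (- k * p.1 + k * p.2) + expR (- k * p.1 + - k * p.2)))).
- apply: measurableT_comp => //; apply: measurable_funM => //.
  exact: measurable_normc cmeasurable_idfun.
- move=> p; rewrite ger0_norm ?expR_ge0// !expRD -!mulrDr -mulrDl.
  apply: (@le_trans _ _ (expR (k * `|p.1|) * expR (k * `|p.2|))).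
    rewrite -expRD ler_expR -mulrDr (le_trans (ler_norm _))// normrM ler_wpM2l//.
    by rewrite ger0_norm ?normc_ge0// normc_le_ReIm.
  by rewrite ler_pM ?expR_ge0.
- by do !apply: gintegrableD; exact: gintegrable_expR_linear.
Qed.

End gaussian_mean.

(** * Complex Gaussian means and integrals against the kernel *)

Section complex_gaussian_mean.
Context {R : realType}.
Local Notation plane := (measurableTypeR R * measurableTypeR R)%type.
Local Notation leb2 := (@leb2 R).
Implicit Types (F G : R[i] -> R[i]).

Definition cgintegrable F : Prop :=
  cmeasurable F /\ gintegrable (fun p => normc (F (cplx p))).

Definition cgmean F : R[i] :=
  gmean (fun p => complex.Re (F (cplx p))) +i* gmean (fun p => complex.Im (F (cplx p))).

Lemma cgintegrable_ReIm F : cgintegrable F ->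
  gintegrable (fun p => complex.Re (F (cplx p))) /\
  gintegrable (fun p => complex.Im (F (cplx p))).
Proof.
move=> [[mr mi] iF]; split; apply: gintegrable_le iF => // p.
  exact: Re_le_normc.
exact: Im_le_normc.
Qed.

Lemma cgintegrable_le F (g : plane -> R) : cmeasurable F ->
  (forall p, normc (F (cplx p)) <= g p) -> gintegrable g -> cgintegrable F.
Proof.
move=> mF Fg ig; split => //; apply: gintegrable_le ig; first exact: measurable_normc.
by move=> p; rewrite ger0_norm ?normc_ge0.
Qed.

Lemma cgintegrableD F G : cgintegrable F -> cgintegrable G ->
  cgintegrable (fun z => F z + G z).
Proof.
move=> [mF iF] [mG iG]; apply: (cgintegrable_le _ _ _ _ (gintegrableD _ _ iF iG)).
  exact: cmeasurableD.
by move=> p; exact: normc_le_add.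
Qed.

Lemma cgintegrableZ (c : R[i]) F : cgintegrable F -> cgintegrable (fun z => c * F z).
Proof.
move=> [mF iF]; apply: (cgintegrable_le _ _ _ _ (gintegrableZ (normc c) _ iF)).
  by apply: cmeasurableM => //; exact: cmeasurable_cst.
by move=> p; rewrite normcM.
Qed.

Lemma cgintegrableB F G : cgintegrable F -> cgintegrable G ->
  cgintegrable (fun z => F z - G z).
Proof.
move=> iF iG; have := cgintegrableD _ _ iF (cgintegrableZ (-1) _ iG).
by congr cgintegrable; apply/funext => z; rewrite mulN1r.
Qed.

Lemma cgmeanD F G : cgintegrable F -> cgintegrable G ->
  cgmean (fun z => F z + G z) = cgmean F + cgmean G.
Proof.
move=> /cgintegrable_ReIm[rF iF] /cgintegrable_ReIm[rG iG].
apply/eqP; rewrite eq_complex /= -!gmeanD//; apply/andP; split; apply/eqP;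
  by congr gmean; apply/funext => p; case: (F _) (G _) => a b [].
Qed.

Lemma cgmeanZ (c : R[i]) F : cgintegrable F ->
  cgmean (fun z => c * F z) = c * cgmean F.
Proof.
move=> /cgintegrable_ReIm[rF iF]; case: c => a b.
have iZ k f : gintegrable f -> gintegrable (fun p : plane => k * f p) by exact: gintegrableZ.
apply/eqP; rewrite eq_complex /= -mulNr -!gmeanZ// -!gmeanD; [|exact: iZ..].
by apply/andP; split; apply/eqP; congr gmean; apply/funext => p; case: (F _) => x y /=; ring.
Qed.

Lemma cgmeanB F G : cgintegrable F -> cgintegrable G ->
  cgmean (fun z => F z - G z) = cgmean F - cgmean G.
Proof.
move=> iF iG; rewrite -(mulN1r (cgmean G)) -cgmeanZ// -cgmeanD//; last exact: cgintegrableZ.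
by congr cgmean; apply/funext => z; rewrite mulN1r.
Qed.

(** Multiplying by the conjugate of the mean L makes it real: |L|^2 is the mean of Re(conj(L) F),
    which is at most |L| times the mean of |F|. *)
Lemma normc_cgmean F : cgintegrable F ->
  normc (cgmean F) <= gmean (fun p => normc (F (cplx p))).
Proof.
move=> iF; have [_ nF] := iF; set L := cgmean F; set N := gmean _.
have [->|L0] := eqVneq L 0; first by rewrite normc0 gmean_ge0// => p; exact: normc_ge0.
have nL : 0 < normc L.
  by rewrite lt_neqAle normc_ge0 andbT eq_sym; apply: contra L0 => /eqP/eq0_normc ->.
rewrite -(ler_pM2l nL) -expr2.
have iLF := cgintegrableZ (conjc L) _ iF.
have -> : normc L ^+ 2 = gmean (fun p => complex.Re (conjc L * F (cplx p))).
  rewrite -[RHS]/(complex.Re (cgmean (fun z => conjc L * F z))) cgmeanZ// -/L.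
  by rewrite sqr_normcE; case: (L) => a b /=; ring.
rewrite /N -gmeanZ//; have [rLF _] := cgintegrable_ReIm _ iLF.
apply: gmean_le => //; first exact: gintegrableZ.
move=> p; rewrite (le_trans (ler_norm _))// (le_trans (Re_le_normc _))//.
by rewrite normcM normc_conj.
Qed.

Definition square_gintegrable F : Prop :=
  cmeasurable F /\ gintegrable (fun p => normc (F (cplx p)) ^+ 2).

Definition gnorm F : R := Num.sqrt (gmean (fun p => normc (F (cplx p)) ^+ 2)).

Lemma gnorm_ge0 F : 0 <= gnorm F. Proof. exact: sqrtr_ge0. Qed.

Lemma sqr_gnorm F : gnorm F ^+ 2 = gmean (fun p => normc (F (cplx p)) ^+ 2).
Proof. by rewrite sqr_sqrtr// gmean_ge0// => p; exact: sqr_ge0. Qed.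

Lemma gintegrable_normcM F G : square_gintegrable F -> square_gintegrable G ->
  gintegrable (fun p => normc (F (cplx p)) * normc (G (cplx p))).
Proof.
move=> [mF iF] [mG iG]; apply: (gintegrable_le _ _ _ _ (gintegrableD _ _ iF iG)).
  by apply: measurable_funM; exact: measurable_normc.
move=> p; rewrite ger0_norm ?mulr_ge0 ?normc_ge0//.
have := sqr_ge0 (normc (F (cplx p)) - normc (G (cplx p))).
have := mulr_ge0 (normc_ge0 (F (cplx p))) (normc_ge0 (G (cplx p))).
by rewrite sqrrB; lra.
Qed.

Lemma cgintegrableM F G : square_gintegrable F -> square_gintegrable G ->
  cgintegrable (fun z => F z * G z).
Proof.
move=> sF sG; apply: (cgintegrable_le _ _ _ _ (gintegrable_normcM _ _ sF sG)).
  by apply: cmeasurableM; [case: sF|case: sG].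
by move=> p; rewrite normcM.
Qed.

Lemma cgmean_cauchy_schwarz F G : square_gintegrable F -> square_gintegrable G ->
  normc (cgmean (fun z => F z * G z)) <= gnorm F * gnorm G.
Proof.
move=> sF sG; apply: (le_trans (normc_cgmean _ (cgintegrableM _ _ sF sG))).
rewrite (_ : (fun p => _) = (fun p => normc (F (cplx p)) * normc (G (cplx p)))); last first.
  by apply/funext => p; rewrite normcM.
by apply: gmean_cauchy_schwarz; [case: sF|case: sG|exact: gintegrable_normcM].
Qed.

Lemma square_gintegrable_le F (K c : R) : cmeasurable F ->
  (forall z, normc (F z) <= K * expR (c * normc z)) -> square_gintegrable F.
Proof.
move=> mF Fc; split => //.
apply: (gintegrable_le _ _ _ _ (gintegrableZ (K ^+ 2) _ (gintegrable_expR_normc (2 * c)))).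
  by apply: measurable_funX; exact: measurable_normc.
move=> p; rewrite ger0_norm ?sqr_ge0// -mulrA expRM_natl -exprMn.
by rewrite ler_pXn2r ?nnegrE ?normc_ge0//; exact: le_trans (normc_ge0 _) (Fc _).
Qed.

Lemma square_gintegrableM (c : R[i]) F : square_gintegrable F ->
  square_gintegrable (fun z => c * F z).
Proof.
move=> [mF iF]; split; first by apply: cmeasurableM => //; exact: cmeasurable_cst.
rewrite (_ : (fun p => _) = (fun p => normc c ^+ 2 * normc (F (cplx p)) ^+ 2)).
  exact: gintegrableZ.
by apply/funext => p; rewrite normcM exprMn.
Qed.

(* The derivatives of the reproducing kernel exp(a conj(w)) with respect to [a]. *)
Definition bkernel (m : nat) (a w : R[i]) : R[i] := conjc w ^+ m * cexp (a * conjc w).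

Lemma normc_bkernel_le m a w :
  normc (bkernel m a w) <= expR ((m%:R + normc a) * normc w).
Proof.
rewrite /bkernel normcM normcX normc_conj mulrDl expRD.
rewrite ler_pM ?exprn_ge0 ?normc_ge0//.
  rewrite expRM_natl lerXn2r ?nnegrE ?normc_ge0 ?expR_ge0//.
  by rewrite (le_trans _ (expR_ge1Dx _))// lerDr.
by rewrite (le_trans (normc_cexp_le _))// normcM normc_conj.
Qed.

Lemma cmeasurable_bkernel m a : cmeasurable (bkernel m a).
Proof.
apply: cmeasurableM; first exact/cmeasurableX/cmeasurable_conj/cmeasurable_idfun.
apply/cmeasurable_cexp/cmeasurableM; first exact: cmeasurable_cst.
exact/cmeasurable_conj/cmeasurable_idfun.
Qed.

Lemma square_gintegrable_bkernel m a : square_gintegrable (bkernel m a).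
Proof.
apply: (square_gintegrable_le _ 1 (m%:R + normc a)); first exact: cmeasurable_bkernel.
by move=> z; rewrite mul1r normc_bkernel_le.
Qed.

(** For [m = 0] this is the Bargmann projection of [F], and for larger [m] its m-th derivative
    ([cderiv_bproj]), written as an integral that is meaningful for every square integrable [F]. *)
Definition bproj (m : nat) F (a : R[i]) : R[i] := cgmean (fun w => F w * bkernel m a w).

Lemma normc_bproj_le m F a : square_gintegrable F ->
  normc (bproj m F a) <= gnorm F * gnorm (bkernel m a).
Proof. by move=> sF; exact: cgmean_cauchy_schwarz _ (square_gintegrable_bkernel m a). Qed.

Lemma bprojB m F G a : square_gintegrable F -> square_gintegrable G ->
  bproj m (fun z => F z - G z) a = bproj m F a - bproj m G a.
Proof.
move=> sF sG; have sk := square_gintegrable_bkernel m a.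
rewrite /bproj -cgmeanB; [|exact: cgintegrableM..].
by congr cgmean; apply/funext => z; rewrite mulrBl.
Qed.

(** Passing from a to a + h multiplies the kernel by exp(h conj(w)), so this is the second-order
    remainder of the exponential. The bound is |h|^2 times a function of [w] alone with exponential
    growth, hence square integrable: the majorant for differentiating under the integral. *)
Lemma bkernel_taylor m a h w : normc h <= 1 ->
  normc (bkernel m (a + h) w - bkernel m a w - h * bkernel m.+1 a w) <=
  normc h ^+ 2 * (3 * expR ((m.+2%:R + normc a + 1) * normc w)).
Proof.
move=> h1; pose k := h * conjc w.
rewrite (_ : _ - _ = bkernel m a w * (cexp k - 1 - k)); last first.
  by rewrite /bkernel /k mulrDl cexpD exprS; ring.
rewrite normcM; have kw : normc k = normc h * normc w by rewrite /k normcM normc_conj.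
apply: (le_trans (ler_pM (normc_ge0 _) (normc_ge0 _) (normc_bkernel_le m a w) (normc_cexpB1 k))).
rewrite kw exprMn; set e := expR _.
have w2 : normc w ^+ 2 <= expR (2 * normc w).
  rewrite expRM_natl lerXn2r ?nnegrE ?normc_ge0 ?expR_ge0//.
  by rewrite (le_trans _ (expR_ge1Dx _))// lerDr.
have w1 : expR (normc h * normc w) <= expR (normc w).
  by rewrite ler_expR ler_piMl ?normc_ge0.
rewrite (_ : e * _ = normc h ^+ 2 * (3 * (e * (normc w ^+ 2 * expR (normc h * normc w))))); last first.
  by ring.
(* In the exponent, m + |a| comes from the kernel, 2 from |w|^2 <= exp(2 |w|), and 1 from exp(|h|
   |w|) with |h| <= 1. *)
rewrite ler_wpM2l ?sqr_ge0// ler_wpM2l// (_ : (_ + 1) * _ =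
  (m%:R + normc a) * normc w + (2 * normc w + normc w)); last by rewrite -[m.+2]addn2 natrD; ring.
rewrite [leRHS]expRD ler_wpM2l ?expR_ge0// expRD ler_pM ?sqr_ge0 ?expR_ge0//.
Qed.

Lemma cderiv_bproj m F a : square_gintegrable F ->
  cderiv (bproj m F) a (bproj m.+1 F a).
Proof.
move=> sF; have iM k b := cgintegrableM _ _ sF (square_gintegrable_bkernel k b).
pose c := m.+2%:R + normc a + 1.
pose E (w : R[i]) : R[i] := (3 * expR (c * normc w))%:C.
have nE z : normc (E z) = 3 * expR (c * normc z).
  by rewrite normc_real ger0_norm// mulr_ge0// expR_ge0.
have sE : square_gintegrable E.
  apply: (square_gintegrable_le _ 3 c); last by move=> z; rewrite nE.
  split; last exact: measurable_cst.
  apply: measurable_funM => //; apply: measurableT_comp => //; apply: measurable_funM => //.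
  exact: measurable_normc cmeasurable_idfun.
pose C := gmean (fun p => normc (F (cplx p)) * normc (E (cplx p))).
have iFE := gintegrable_normcM _ _ sF sE.
have C0 : 0 <= C by apply: gmean_ge0 => p; rewrite mulr_ge0 ?normc_ge0.
have key h : normc h <= 1 ->
    normc (bproj m F (a + h) - bproj m F a - bproj m.+1 F a * h) <= normc h ^+ 2 * C.
  move=> h1; rewrite mulrC /bproj -cgmeanZ// -!cgmeanB//; last 2 first.
  - exact: cgintegrableB.
  - exact: cgintegrableZ.
  set G := (fun z => _).
  have GE z : G z = F z * (bkernel m (a + h) z - bkernel m a z - h * bkernel m.+1 a z).
    by rewrite /G; ring.
  have Gle p : normc (G (cplx p)) <= normc h ^+ 2 * (normc (F (cplx p)) * normc (E (cplx p))).
    rewrite GE normcM [leRHS]mulrCA ler_wpM2l ?normc_ge0// nE.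
    exact: bkernel_taylor.
  have iG : cgintegrable G.
    apply: (cgintegrable_le _ _ _ Gle); last exact: gintegrableZ.
    rewrite (funext GE); apply: cmeasurableM; first by case: sF.
    apply: cmeasurableB; first by apply: cmeasurableB; exact: cmeasurable_bkernel.
    by apply: cmeasurableM; [exact: cmeasurable_cst|exact: cmeasurable_bkernel].
  apply: (le_trans (normc_cgmean _ iG)).
  rewrite -gmeanZ//; apply: gmean_le => //; first by case: iG.
  exact: gintegrableZ.
(* [C] may vanish, hence the denominator [C + 1]. *)
move=> e e0; exists (Order.min 1 (e / (C + 1))); first by rewrite lt_min ltr01 divr_gt0// ltr_wpDl.
move=> h; rewrite lt_min ltr_pdivlMr ?ltr_wpDl// => /andP[/ltW h1 he].
apply: (le_trans (key _ h1)); rewrite expr2 -mulrA mulrC ler_wpM2r ?normc_ge0//.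
by rewrite (le_trans _ (ltW he))// ler_wpM2l ?normc_ge0// lerDl.
Qed.

Lemma entire_bproj F : square_gintegrable F -> entire (bproj 0 F).
Proof. by move=> sF; apply/entireP => z; eexists; exact: cderiv_bproj. Qed.

End complex_gaussian_mean.

(** * The reproducing formula *)

Section reproducing.
Context {R : realType}.
Local Notation plane := (measurableTypeR R * measurableTypeR R)%type.
Local Notation leb2 := (@leb2 R).
Implicit Types (F : R[i] -> R[i]).

Lemma cderiv_cexp_linear (c z : R[i]) :
  cderiv (fun x => cexp (c * x)) z (c * cexp (c * z)).
Proof.
rewrite mulrC; apply: (cderiv_comp cexp (fun x => c * x)); first exact: cderiv_cexp.
have := cderivM _ _ _ _ _ (cderiv_cst c z) (cderiv_id z).
by rewrite mul0r add0r mulr1.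
Qed.

(** With w = a + u, the exponent a conj(w) - |w|^2 equals - conj(a) u - |u|^2: the antiholomorphic
    term a conj(u) cancels. The translated integrand is therefore an entire function of u, with
    value F(a) at 0, times the Gaussian. *)
Let Re_bproj0 F a : entire F -> square_gintegrable F ->
  complex.Re (bproj 0 F a) = complex.Re (F a).
Proof.
move=> eF sF; have [mF _] := sF.
pose T (p : plane) : plane := (p.1 + complex.Re a, p.2 + complex.Im a).
have pT : leb2_preserving T by exact: leb2_preserving_translation.
have TE p : cplx (T p) = a + cplx p.
  by rewrite /cplx /T; case: a {T pT} => x y; rewrite /= addrC (addrC _ y).
pose h w := F w * bkernel 0 a w.
have ih : cgintegrable h by apply: cgintegrableM => //; exact: square_gintegrable_bkernel.
have [rh _] := cgintegrable_ReIm _ ih.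
pose G z := F (a + z) * cexp (- conjc a * z).
have GE p : complex.Re (h (cplx (T p))) * gauss2 (T p) = complex.Re (G (cplx p)) * gauss2 p.
  rewrite gauss2_translation mulrA; congr (_ * _).
  rewrite TE /h /G; move: (F _) => u; rewrite -expRD.
  have ReM (v : R[i]) k : complex.Re v * k = complex.Re (v * k%:C).
    by case: v => x y /=; ring.
  rewrite (ReM (u * _)) -mulrA; congr (complex.Re (_ * _)).
  rewrite /bkernel expr0 mul1r -cexp_real -cexpD; congr cexp.
  by case: a {T pT TE h ih rh G ReM} => x y; apply/eqP; rewrite eq_complex /=;
    apply/andP; split; apply/eqP; ring.
have eG : entire G.
  apply/entireP => z; have [l Fl] := (entireP F).1 eF (a + z).
  eexists; apply: cderivM; last exact: cderiv_cexp_linear.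
  apply: (cderiv_comp F (fun x => a + x)); first exact: Fl.
  exact: cderivD (cderiv_cst _ _) (cderiv_id _).
have mG : cmeasurable G.
  apply: cmeasurableM; first exact: cmeasurable_translation.
  by apply/cmeasurable_cexp/cmeasurableM; [exact: cmeasurable_cst|exact: cmeasurable_idfun].
have mrh : measurable_fun setT (fun p : plane => (complex.Re (h (cplx p)) * gauss2 p)%:E).
  exact: measurable_int rh.
(* Integrability is carried over by the translation from [h], a product of two square integrable
   functions. *)
have iG : leb2.-integrable setT (fun p => (complex.Re (G (cplx p)) * gauss2 p)%:E).
  have := integrable_preserving _ pT _ mrh rh.
  by apply: eq_integrable => // p _; rewrite /= GE.
have := area_mean G eG mG iG.
have -> : (\int[leb2]_p (complex.Re (G (cplx p)) * gauss2 p)%:E =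
    \int[leb2]_p (complex.Re (h (cplx p)) * gauss2 p)%:E)%E.
  by rewrite -(integral_preserving _ pT _ mrh); apply: eq_integral => p _; rewrite -GE.
move=> hE; rewrite /bproj /cgmean/= /gmean /Rintegral.
rewrite [X in fine X]hE /= mulrA mulVf ?mul1r ?gt_eqF ?pi_gt0//.
by rewrite /G addr0 mulr0 cexp0 mulr1.
Qed.

(** The imaginary part is the real part for - i F, which is again entire and square integrable. *)
Lemma bproj0_entire F a : entire F -> square_gintegrable F -> bproj 0 F a = F a.
Proof.
move=> eF sF; apply/eqP; rewrite eq_complex (Re_bproj0 _ _ eF sF) eqxx andTb; apply/eqP.
pose G z := - 'i * F z.
have eG : entire G.
  apply/entireP => z; have [l Fl] := (entireP F).1 eF z.
  by eexists; exact: cderivM (cderiv_cst _ _) Fl.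
have sG : square_gintegrable G by exact: square_gintegrableM.
have := Re_bproj0 _ a eG sG.
have -> : bproj 0 G a = - 'i * bproj 0 F a.
  rewrite /bproj -cgmeanZ; last by apply: cgintegrableM => //; exact: square_gintegrable_bkernel.
  by congr cgmean; apply/funext => z; rewrite /G mulrA.
rewrite /G; case: (F a) (bproj _ _ _) => x y [x' y'] /=.
by rewrite oppr0 !mul0r !mulN1r !sub0r !opprK.
Qed.

Lemma bproj1_entire F z l : entire F -> square_gintegrable F -> cderiv F z l ->
  bproj 1 F z = l.
Proof.
move=> eF sF Fl; apply: (cderiv_unique F z) => //.
have := cderiv_bproj 0 F z sF; congr cderiv.
by apply/funext => w; rewrite bproj0_entire.
Qed.

Lemma bproj2_entire F F' z l : entire F -> square_gintegrable F ->
  (forall w, cderiv F w (F' w)) -> cderiv F' z l -> bproj 2 F z = l.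
Proof.
move=> eF sF FF' F'l; apply: (cderiv_unique F' z) => //.
have := cderiv_bproj 1 F z sF; congr cderiv.
by apply/funext => w; apply: bproj1_entire.
Qed.

(** The conjugate of [bkernel m a w]. It is entire in [w], so the reproducing formula and its
    derivatives apply to it. *)
Let ckernel m a w : R[i] := w ^+ m * cexp (conjc a * w).

Let ckernelE m a w : ckernel m a w = conjc (bkernel m a w).
Proof.
have cM (x y : R[i]) : conjc (x * y) = conjc x * conjc y by exact: rmorphM.
have cX (x : R[i]) n : conjc (x ^+ n) = conjc x ^+ n by exact: rmorphXn.
by rewrite /bkernel cM cX conjc_cexp cM !conjcK.
Qed.

Let square_gintegrable_ckernel m a : square_gintegrable (ckernel m a).
Proof.
rewrite (_ : ckernel m a = fun w => conjc (bkernel m a w)); last first.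
  by apply/funext => w; rewrite ckernelE.
have [mk ik] := square_gintegrable_bkernel m a; split; first exact: cmeasurable_conj.
by move: ik; congr gintegrable; apply/funext => p; rewrite normc_conj.
Qed.

(* The kernel tested against itself: its norm is a derivative of the entire
   function [w ^+ m * cexp (conjc a * w)] at [a]. *)
Let gnorm_bkernel m a (x : R) : bproj m (ckernel m a) a = x%:C ->
  gnorm (bkernel m a) = Num.sqrt x.
Proof.
move=> bx; rewrite /gnorm; congr Num.sqrt.
rewrite -[x]/(complex.Re x%:C) -bx /bproj /cgmean /=; congr gmean.
apply/funext => p; rewrite ckernelE sqr_normcE.
by case: (bkernel _ _ _) => u v /=; ring.
Qed.

Let mulcJ (a : R[i]) : conjc a * a = (normc a ^+ 2)%:C.
Proof.
by rewrite sqr_normcE; case: a => x y; apply/eqP; rewrite eq_complex /=;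
  apply/andP; split; apply/eqP; ring.
Qed.

Let ckernel_cderiv0 a z : cderiv (ckernel 0 a) z (conjc a * ckernel 0 a z).
Proof.
rewrite /ckernel (_ : (fun w => _) = (fun w => cexp (conjc a * w))).
  by rewrite expr0 mul1r; exact: cderiv_cexp_linear.
by apply/funext => w; rewrite expr0 mul1r.
Qed.

Let ckernel_cderiv m a z :
  cderiv (ckernel m.+1 a) z (m.+1%:R * ckernel m a z + conjc a * ckernel m.+1 a z).
Proof.
elim: m => [|m IH].
  have := cderivM _ _ _ _ _ (cderiv_id z) (ckernel_cderiv0 a z).
  rewrite (_ : _ + _ = 1%:R * ckernel 0 a z + conjc a * ckernel 1 a z).
    by congr cderiv; apply/funext => w; rewrite /ckernel expr0 mul1r expr1.
  by rewrite /ckernel expr0 expr1; ring.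
have := cderivM _ _ _ _ _ (cderiv_id z) IH.
rewrite (_ : 1 * _ + _ = m.+2%:R * ckernel m.+1 a z + conjc a * ckernel m.+2 a z).
  by congr cderiv; apply/funext => w; rewrite /ckernel [in RHS]exprS mulrA.
by rewrite /ckernel -[m.+2%:R]natr1 !exprS; ring.
Qed.

Let entire_ckernel m a : entire (ckernel m a).
Proof.
apply/entireP => z; case: m => [|m]; eexists; first exact: ckernel_cderiv0.
exact: ckernel_cderiv.
Qed.

Let sqrt_expR (x : R) : Num.sqrt (expR x) = expR (x / 2).
Proof.
have -> : expR x = expR (x / 2) ^+ 2 by rewrite -expRM_natl; congr expR; field.
by rewrite sqrtr_sqr ger0_norm ?expR_ge0.
Qed.

Lemma gnorm_bkernel0 (a : R[i]) : gnorm (bkernel 0 a) = expR (normc a ^+ 2 / 2).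
Proof.
rewrite -sqrt_expR; apply: gnorm_bkernel.
rewrite bproj0_entire; [|exact: entire_ckernel|exact: square_gintegrable_ckernel].
by rewrite /ckernel expr0 mul1r mulcJ cexp_real.
Qed.

Lemma gnorm_bkernel1 (a : R[i]) :
  gnorm (bkernel 1 a) = Num.sqrt (1 + normc a ^+ 2) * expR (normc a ^+ 2 / 2).
Proof.
rewrite -sqrt_expR -sqrtrM ?addr_ge0 ?sqr_ge0//; apply: gnorm_bkernel.
rewrite (bproj1_entire _ _ _ (entire_ckernel _ _) (square_gintegrable_ckernel _ _)
  (ckernel_cderiv 0 a a)).
rewrite /ckernel expr0 expr1 mul1r mul1r mulcJ cexp_real mulrA mulcJ.
apply/eqP; move: (normc a) (expR _) => n e; rewrite eq_complex /=.
by apply/andP; split; apply/eqP; ring.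
Qed.

(** The second derivative of w^2 exp(conj(a) w) is (2 + 4 conj(a) w + (conj(a) w)^2) exp(conj(a) w),
    evaluated at w = a. The coefficient 1 is written out to match the shape of the third bound of
    the theorem. *)
Lemma gnorm_bkernel2 (a : R[i]) : gnorm (bkernel 2 a) =
  Num.sqrt (2 + 4 * normc a ^+ 2 + 1 * normc a ^+ 4) * expR (normc a ^+ 2 / 2).
Proof.
rewrite -sqrt_expR -sqrtrM; last by rewrite !addr_ge0 ?mulr_ge0 ?exprn_ge0 ?normc_ge0.
apply: gnorm_bkernel.
have cM (c l z : R[i]) F : cderiv F z l -> cderiv (fun x => c * F x) z (c * l).
  by move=> Fl; have := cderivM _ _ _ _ _ (cderiv_cst c z) Fl; rewrite mul0r add0r.
rewrite (bproj2_entire _ _ _ _ (entire_ckernel _ _) (square_gintegrable_ckernel _ _)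
  (ckernel_cderiv 1 a) (cderivD _ _ _ _ _ (cM _ _ _ _ (ckernel_cderiv 0 a a))
    (cM _ _ _ _ (ckernel_cderiv 1 a a)))).
rewrite /ckernel expr0 expr1 mulcJ cexp_real mul1r.
transitivity ((2 + 4 * (conjc a * a) + (conjc a * a) ^+ 2) * (expR (normc a ^+ 2))%:C).
  by ring.
rewrite mulcJ; move: (normc a) (expR _) => n e.
by apply/eqP; rewrite -!natr1 eq_complex /=; apply/andP; split; apply/eqP; ring.
Qed.

End reproducing.

(** * The Bargmann space *)

Section bargmann_space.
Context {R : realType}.
Local Notation plane := (measurableTypeR R * measurableTypeR R)%type.
Local Notation leb2 := (@leb2 R).
Implicit Types (f : L2fun R).

Lemma L2fun_square_gintegrable f : square_gintegrable f.
Proof.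
split; first exact: L2fun_measurable.
apply/integrableP; split.
  apply/measurable_EFinP; apply: measurable_funM; last exact: measurable_gauss2.
  by apply: measurable_funX; apply: measurable_normc; exact: L2fun_measurable.
rewrite [ltLHS](_ : _ = \int[leb2]_p (normc (f (cplx p)) ^+ 2 * gauss2 p)%:E)%E; last first.
  by apply: eq_integral => p _; rewrite gee0_abs// lee_fin mulr_ge0 ?sqr_ge0 ?gauss2_ge0.
have := L2fun_fin f; rewrite ltey; apply: contraPneq => Iy.
rewrite /enorm /gauss2 in Iy *; rewrite Iy.
by rewrite gt0_muley ?lte_fin ?invr_gt0 ?pi_gt0// poweRyr.
Qed.

Lemma l2norm_gnorm f : l2norm f = gnorm f.
Proof.
have [_ /integrable_fin_num If] := L2fun_square_gintegrable f.
rewrite /l2norm /enorm fine_poweR fineM//; last exact: If.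
rewrite powR12_sqrt//.
rewrite mulr_ge0 ?invr_ge0 ?pi_ge0// fine_ge0// integral_ge0// => p _.
by rewrite lee_fin mulr_ge0 ?sqr_ge0 ?expR_ge0.
Qed.

Lemma normc_bproj_le_l2norm m f z :
  normc (bproj m f z) <= gnorm (bkernel m z) * l2norm f.
Proof.
by rewrite l2norm_gnorm mulrC; apply: normc_bproj_le; exact: L2fun_square_gintegrable.
Qed.

Lemma bargmann_bproj0 f : bargmann R f -> bproj 0 f = f.
Proof.
by move=> ef; apply/funext => z; rewrite bproj0_entire//; exact: L2fun_square_gintegrable.
Qed.

Lemma bargmann_derive1n m f : bargmann R f -> derive1n m f = bproj m f.
Proof.
move=> ef; elim: m => [|m IH]; first by rewrite derive1n0 bargmann_bproj0.
rewrite derive1nS IH; apply/funext => z; apply: cderiv_derive1.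
by apply: cderiv_bproj; exact: L2fun_square_gintegrable.
Qed.

Lemma bargmannL2_submod : submod_closed (mem (bargmannL2 R)).
Proof.
split.
  rewrite inE; exists 0; last exact: raddf0.
  by apply/entireP => z; exists 0; exact: cderiv_cst.
move=> a u v; rewrite !inE => -[f ef <-] [g eg <-]; exists (a *: f + g).
  apply/entireP => z.
  have [l fl] := (entireP f).1 ef z; have [m gm] := (entireP g).1 eg z.
  eexists; apply: cderivD; last exact: gm.
  exact: cderivM (cderiv_cst a z) fl.
by rewrite toL2D toL2Z.
Qed.

(** Fatou's lemma for |G n|^2 times the Gaussian: the integral for the limit is at most the lower
    limit of pi times the squared norms, which is 0. It serves to identify a pointwise limit with a
    limit in norm. *)
Lemma gaussian_fatou (F : R[i] -> R[i]) (G : nat -> R[i] -> R[i]) :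
  (forall n, square_gintegrable (G n)) ->
  (forall z, normc (G n z) @[n --> \oo] --> normc (F z)) ->
  gnorm (G n) @[n --> \oo] --> 0 ->
  enorm F = 0%E.
Proof.
move=> sG GF Gn0.
have cvg_sqr (v : nat -> R) (a : R) : v @ \oo --> a -> (v n ^+ 2) @[n --> \oo] --> a ^+ 2.
  by move=> va; under eq_fun do rewrite expr2; rewrite expr2; exact: cvgM.
pose h n (p : plane) := (normc (G n (cplx p)) ^+ 2 * gauss2 p)%:E.
have mh n : measurable_fun setT (h n).
  by have [_ /measurable_int] := sG n.
have h0 n p : (0 <= h n p)%E by rewrite lee_fin mulr_ge0 ?sqr_ge0 ?gauss2_ge0.
have := @fatou _ _ R leb2 setT measurableT h mh (fun n p _ => h0 n p).
rewrite (_ : limn_einf (fun n => \int[leb2]_p h n p)%E = 0%E); last first.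
  have Ih n : (\int[leb2]_p h n p = (pi * gnorm (G n) ^+ 2)%:E)%E.
    have [_ /integrable_fin_num Gf] := sG n.
    rewrite sqr_gnorm /gmean mulrA divff ?gt_eqF ?pi_gt0// mul1r /Rintegral fineK//.
    exact: Gf.
  apply: (cvg_limn_einf_sup _).1.
  under eq_fun do rewrite Ih.
  apply: cvg_EFin; first by near=> n.
  rewrite (_ : _ \o _ = (fun n => pi * gnorm (G n) ^+ 2))//.
  rewrite -[X in _ --> X](_ : pi * 0 ^+ 2 = 0); last by rewrite expr0n mulr0.
  by apply: cvgMl_tmp; apply: cvg_sqr.
rewrite (_ : (fun p => _) = (fun p => (normc (F (cplx p)) ^+ 2 * gauss2 p)%:E)); last first.
  apply/funext => p; apply: (cvg_limn_einf_sup _).1.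
  apply: cvg_EFin; first by near=> n.
  by apply: cvgMr_tmp; apply: cvg_sqr; exact: GF.
move=> I0; rewrite /enorm.
have -> : (\int[leb2]_p (normc (F (cplx p)) ^+ 2 * expR (- normc (cplx p) ^+ 2))%:E = 0)%E.
  apply/eqP; rewrite eq_le I0/= integral_ge0// => p _.
  by rewrite lee_fin mulr_ge0 ?sqr_ge0 ?expR_ge0.
by rewrite mule0 poweR0r.
Unshelve. all: by end_near. Qed.

Lemma cmeasurable_cvg (G : nat -> R[i] -> R[i]) (F : R[i] -> R[i]) :
  (forall n, cmeasurable (G n)) ->
  (forall z, normc (G n z - F z) @[n --> \oo] --> 0) -> cmeasurable F.
Proof.
move=> mG GF.
have GR z : complex.Re (G n z) @[n --> \oo] --> complex.Re (F z).
  apply/cvgrPdist_le => e e0; have /cvgrPdist_le /(_ _ e0) := GF z.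
  apply: filterS => n; rewrite sub0r normrN ger0_norm ?normc_ge0// normc_distC.
  by apply: le_trans; apply: le_trans (Re_le_normc _); case: (F z) (G n z) => a b [].
have GI z : complex.Im (G n z) @[n --> \oo] --> complex.Im (F z).
  apply/cvgrPdist_le => e e0; have /cvgrPdist_le /(_ _ e0) := GF z.
  apply: filterS => n; rewrite sub0r normrN ger0_norm ?normc_ge0// normc_distC.
  by apply: le_trans; apply: le_trans (Im_le_normc _); case: (F z) (G n z) => a b [].
split.
  apply: (@measurable_fun_cvg _ _ _ _ (fun n p => complex.Re (G n (cplx p)))).
    by move=> n; case: (mG n).
  by move=> p _; exact: GR.
apply: (@measurable_fun_cvg _ _ _ _ (fun n p => complex.Im (G n (cplx p)))).
  by move=> n; case: (mG n).
by move=> p _; exact: GI.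
Qed.

Lemma closed_bargmannL2 : closed (bargmannL2 R).
Proof.
move=> u cu; pose f := repr u.
have : forall n : nat, exists g : L2fun R, bargmann R g /\ l2norm (g - f) < n.+1%:R^-1.
  move=> n; have e0 : 0 < (n.+1%:R^-1)%:C :> R[i] by rewrite ltcR invr_gt0.
  have [_ [[g eg <-]]] := cu _ (nbhsx_ballx u _ e0).
  rewrite -ball_normE /= => ug; exists g; split => //.
  by rewrite -ltcR -L2normE toL2B toL2K distrC.
move=> /choice[g gP].
have sf := L2fun_square_gintegrable f.
pose psi := bproj 0 f.
have epsi : entire psi by exact: entire_bproj.
have inv0 : (n.+1%:R^-1 : R) @[n --> \oo] --> (0 : R) by exact: cvg_harmonic.
(* As [g n] reproduces itself, the difference is the projection of g n - f at [z], bounded by the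
   norm of the kernel at [z] times that of g n - f. *)
have gpsi z : normc (g n z - psi z) @[n --> \oo] --> 0.
  pose K := gnorm (bkernel 0 z).
  apply: (@squeeze_cvgr _ _ _ _ (fun=> 0) (fun n => K * n.+1%:R^-1)); last 2 first.
  - exact: cvg_cst.
  - by rewrite -[X in _ --> X](mulr0 K); apply: cvgMl_tmp.
  near=> n; rewrite normc_ge0/=.
  have [eg ng] := gP n.
  rewrite -[g n z]/(L2val (g n) z) -(bargmann_bproj0 _ eg) /psi -bprojB//;
    last exact: L2fun_square_gintegrable.
  apply: le_trans (normc_bproj_le_l2norm 0 (g n - f) z) _.
  by rewrite ler_wpM2l ?gnorm_ge0// ltW.
have mpsi : cmeasurable psi.
  by apply: (cmeasurable_cvg g) => // n; exact: L2fun_measurable.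
pose F : R[i] -> R[i] := fun z => psi z - f z.
have F0 : enorm F = 0%E.
  apply: (gaussian_fatou F (fun n => g n - f : L2fun R)).
  - by move=> n; exact: L2fun_square_gintegrable.
  - move=> z; apply/cvgrPdist_le => e e0; have /cvgrPdist_le /(_ _ e0) := gpsi z.
    apply: filterS => n; rewrite sub0r normrN ger0_norm ?normc_ge0//; apply: le_trans.
    rewrite -[X in `|_ - normc X|]/(g n z - f z) /F; set a := g n z; set b := psi z; set c := f z.
    have h1 := normc_le_add (a - b) (b - c); have h2 := normc_le_add (b - a) (a - c).
    rewrite addrA subrK in h1; rewrite addrA subrK in h2.
    by rewrite (normc_distC b a) in h2; rewrite ler_norml; apply/andP; split; lra.
  - under eq_fun do rewrite -l2norm_gnorm.
    apply: (@squeeze_cvgr _ _ _ _ (fun=> 0) (fun n => n.+1%:R^-1)) => //; last exact: cvg_cst.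
    near=> n; have [_ /ltW ->] := gP n; rewrite l2norm_gnorm gnorm_ge0//.
have mF : cmeasurable F by apply: cmeasurableB => //; exact: L2fun_measurable.
have psif : {ae leb2, forall p, psi (cplx p) = f (cplx p)}.
  apply: filterS (enorm_eq0 mF F0) => p.
  by move=> /eqP; rewrite subr_eq0 => /eqP.
(* Finiteness of the norm of [psi] is inherited from [f], with which it agrees almost everywhere. *)
have lpsi : psi \in l2pred R.
  rewrite inE /=; split => //.
  rewrite (ae_eq_enorm mpsi (L2fun_measurable f) psif).
  by have := valP f; rewrite inE => -[].
exists (MkL2fun lpsi); first exact: epsi.
by rewrite -[RHS]toL2K; apply/toL2_eq.
Unshelve. all: by end_near. Qed.

End bargmann_space.

Theorem proposition2p16 (R : realType) :
  (exists a0 a1 a2 : R, [/\ 0 < a0, 0 < a1, 0 < a2 &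
    forall phi : L2fun R, bargmann R phi -> forall z : R[i],
      [/\ normc (phi z) <= expR (normc z ^+ 2 / 2) * l2norm phi,
          normc (phi^`() z) <=
            Num.sqrt (1 + normc z ^+ 2) * expR (normc z ^+ 2 / 2) * l2norm phi &
          normc (phi^`(2) z) <=
            Num.sqrt (a0 + a1 * normc z ^+ 2 + a2 * normc z ^+ 4)
              * expR (normc z ^+ 2 / 2) * l2norm phi]])
  /\ submod_closed (mem (bargmannL2 R)) /\ closed (bargmannL2 R).
Proof.
split; last by split; [exact: bargmannL2_submod|exact: closed_bargmannL2].
(* The coefficients of the squared norm computed in [gnorm_bkernel2]. *)
exists 2, 4, 1; split => // phi ephi z; split.
- have := normc_bproj_le_l2norm 0 phi z.
  by rewrite gnorm_bkernel0 -(bargmann_derive1n 0 _ ephi).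
- have := normc_bproj_le_l2norm 1 phi z.
  by rewrite gnorm_bkernel1 -(bargmann_derive1n 1 _ ephi).
- have := normc_bproj_le_l2norm 2 phi z.
  by rewrite gnorm_bkernel2 -(bargmann_derive1n 2 _ ephi).
Qed.
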